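(* Let $(X,\varrho)$ be a locally compact separable metric space, $\mu$ a nonnegative Radon measure on $X$ with full support and $(\mathcal{E},\mathcal{D}(\mathcal{E}))$ a strongly local regular Dirichlet form on $L^2(X,\mu)$ with carré du champ $\Gamma$. Let $\Theta$ be a directed set, $(j_\theta(x,dy))_{\theta\in\Theta}$ generalized kernels from $X$ to $\mathcal{B}(X)$ and $\mathcal{C}$ a subalgebra of $\mathcal{D}(\mathcal{E})\cap C_b(X)$ satisfying the kernel conditions (K) and the gradient bound (B) listed in the context. Let $N_\ast=(N_p)_{p\ge 0}$ be a system of diagonal neighborhoods for $X$. (i) For any integer $p\ge 0$ the assignment $$\lambda_p(F):=\sum_i g^{(i)}\,d_0f^{(i)}_1\wedge\cdots\wedge d_0f^{(i)}_p\quad\text{for}\quad F=\sum_i \overline{g}^{(i)}\,\delta_{p-1}\mathrm{Alt}_p(f^{(i)}_1\otimes\cdots\otimes f^{(i)}_p)\in\mathcal{C}^p(N_p)\qquad (p\ge1),$$ where $g^{(i)}\in\mathcal{C}\oplus\mathbb{R}$ and $f^{(i)}_1,\dots,f^{(i)}_p\in\mathcal{C}$, respectively $$\lambda_0(f):=f\quad\text{for}\quad f\in\mathcal{C}^0(N_0)=\mathcal{C}\qquad(p=0),$$ defines a linear surjection $\lambda_p:\mathcal{C}^p(N_p)\to\Omega^p(\mathcal{C})$. (ii) The family $\lambda_\ast=(\lambda_p)_{p\ge 0}$ defines a cochain map $\lambda_\ast:(\mathcal{C}^\ast(N_\ast),\delta_\ast)\to(\Omega^\ast(\mathcal{C}),d_\ast)$,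 that is, $d_p\circ\lambda_p=\lambda_{p+1}\circ\delta_p$ for all $p\ge 0$. In particular, it induces well-defined linear maps $\lambda_p^\ast:H^p\mathcal{C}^\ast(N_\ast)\to H^p\Omega^\ast(\mathcal{C})$, $p\ge 0$, between the cohomologies $H^p\mathcal{C}^\ast(N_\ast)=\ker(\delta_p|_{\mathcal{C}^p(N_p)})/\mathrm{im}(\delta_{p-1}|_{\mathcal{C}^{p-1}(N_{p-1})})$ and $H^p\Omega^\ast(\mathcal{C})=\ker (d_p|_{\Omega^p(\mathcal{C})})/\mathrm{im} (d_{p-1}|_{\Omega^{p-1}(\mathcal{C})})$, where $\delta_{-1}:=0$ and $d_{-1}:=0$.
   Context: **Dirichlet forms.** Strongly local: $\mathcal{E}(f,g)=0$ for all $f,g\in C_c(X)\cap\mathcal{D}(\mathcal{E})$ with $g$ constant on a neighborhood of $\mathrm{supp} f$. Regular: $C_c(X)\cap\mathcal{D}(\mathcal{E})$ is dense in $\mathcal{D}(\mathcal{E})$ (norm $(\mathcal{E}(f)+\|f\|_{L^2}^2)^{1/2}$) and in $C_c(X)$ (sup norm). Write $\mathcal{E}(f):=\mathcal{E}(f,f)$. $\mathcal{B}$ is the algebra of bounded measurable functions whose $\mu$-class lies in $\mathcal{D}(\mathcal{E})$. A carré du champ is a map $\Gamma$ with $\Gamma(f)\in L^1(X,\mu)$ and $\mathcal{E}(fh,f)-\frac12\mathcal{E}(f^2,h)=\int_X h\,\Gamma(f)\,d\mu$ for all $f,h\in\mathcal{B}$; it extends to a continuous nonnegative definite symmetric bilinear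 map $\Gamma:\mathcal{D}(\mathcal{E})\times\mathcal{D}(\mathcal{E})\to L^1(X,\mu)$, $\Gamma(f)=\Gamma(f,f)$. **Generalized kernels.** A generalized kernel $j(x,dy)$ from $X$ to $\mathcal{B}(X)^{\otimes p}$ assigns to each Borel $A\subset X^p$ a $\mu$-class $x\mapsto j(x,A)$ of $[0,+\infty]$-valued measurable functions such that for each Borel $B\subset X$ the map $A\mapsto\int_B j(x,A)\,\mu(dx)$ is a Borel measure on $X^p$. Integrals against $j(x,\cdot)$ are understood as $\mu$-classes of functions of $x$. $B(x,\varepsilon)$ is the open ball, $B(x,\varepsilon)^c$ its complement. Limits over $\Theta$ are limits of nets. **Kernel conditions (K).** (i) $j_\theta(x,dy)\mu(dx)=j_\theta(y,dx)\mu(dy)$ for each $\theta$; (ii) $\mathcal{C}$ is dense in $\mathcal{D}(\mathcal{E})$ and in $L^1(X,\mu)$; (iii) for every $f\in\mathcal{C}$ the functions $\Gamma_\theta(f)(x):=\int_X(f(x)-f(y))^2j_\theta(x,dy)$ are in $L^1(X,\mu)$ and $\lim_{\theta\in\Theta}\int_X\Gamma_\theta(f)\,d\mu=\mathcal{E}(f)$; (iv) for any sufficiently small $\varepsilon>0$, $\lim_{\theta\in\Theta}\int_X\int_{B(x,\varepsilon)^c}(f(x)-f(y))^2j_\theta(x,dy)\mu(dx)=0$ for all $f\in\mathcal{C}$. **Gradient bound (B).** For every $f\in\mathcal{C}$: $\Gamma(f)\in L^\infty(X,\mu)$ and $\sup_{\theta\in\Theta}\|\Gamma_\theta(f)\|_{L^\infty(X,\mu)}<+\infty$.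 **Nonlocal complex.** For $F:X^p\to\mathbb{R}$, $\mathrm{Alt}_p(F)(x_1,\dots,x_p)=\frac1{p!}\sum_{\sigma\in\mathcal{S}_p}\mathrm{sgn}(\sigma)F(x_{\sigma(1)},\dots,x_{\sigma(p)})$ and $\delta_{p-1}F(x_0,\dots,x_p)=\sum_{i=0}^p(-1)^iF(x_0,\dots,\hat{x}_i,\dots,x_p)$ ($\hat x_i$ omitted). For $g\in\mathcal{C}\oplus\mathbb{R}$, $\overline{g}(x_0,\dots,x_p)=\frac1{p+1}\sum_{i=0}^pg(x_i)$. $\mathcal{C}^0=\mathcal{C}$ and, for $p\ge1$, $\mathcal{C}^p=\mathrm{span}\{\mathrm{Alt}_{p+1}(f_0\otimes f_1\otimes\cdots\otimes f_p): f_0\in\mathcal{C}\oplus\mathbb{R},\ f_1,\dots,f_p\in\mathcal{C}\}$, which equals $\mathrm{span}\{\overline{g}\,\delta_{p-1}\mathrm{Alt}_p(f_1\otimes\cdots\otimes f_p): g\in\mathcal{C}\oplus\mathbb{R},\ f_i\in\mathcal{C}\}$. A system of diagonal neighborhoods $N_\ast=(N_p)_{p\ge0}$: each $N_p\subset X^{p+1}$ is an open neighborhood of $\{(x,\dots,x):x\in X\}$, invariant under permutations of coordinates, and $(x_0,\dots,x_p)\in N_p$ implies $(x_0,\dots,\hat{x}_i,\dots,x_p)\in N_{p-1}$ for $p\ge1$, $0\le i\le p$. $\mathcal{C}^p(N_p):=\mathcal{C}^p|_{N_p}$ (restrictions); $(\mathcal{C}^\ast(N_\ast),\delta_\ast)$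 is a cochain complex. **First order structure.** Fix $(\varphi_k)_{k\ge1}\subset\mathcal{C}$ whose span $\mathcal{A}$ is $\mathcal{E}^{1/2}$-dense in $\mathcal{B}$, and versions $\widetilde\Gamma(\varphi_i,\varphi_j)$ of $\Gamma(\varphi_i,\varphi_j)$ such that for all $N$ and all $x\in X$ the matrix $(\widetilde\Gamma(\varphi_i,\varphi_j)(x))_{i,j\le N}$ is symmetric nonnegative definite; extend $\widetilde\Gamma$ bilinearly to $\mathcal{A}$. For $x\in X$ let $T_x^\ast X$ be the Hilbert space completion of $\mathcal{A}/\ker\|\cdot\|_{T_x^\ast X}$, $\|u\|_{T_x^\ast X}=\widetilde\Gamma(u,u)(x)^{1/2}$, and $d_{0,x}f$ the class of $f\in\mathcal{A}$. A section $\omega=(\omega_x)_{x\in X}$ is measurable if all $x\mapsto\langle\omega_x,d_{0,x}f\rangle_{T_x^\ast X}$, $f\in\mathcal{A}$, are measurable. The map $f\mapsto(d_{0,x}f)_{x\in X}$ extends uniquely to a linear map $d_0:\mathcal{B}\to L^2(X,T^\ast X,\mu)$ with $\|d_0f\|^2_{L^2(X,T^\ast X,\mu)}=\mathcal{E}(f)$; it satisfies $\langle d_0f,d_0g\rangle_{T_x^\ast X}=\Gamma(f,g)(x)$ for $\mu$-a.e. $x$ and $d_0(fg)=f\,d_0g+g\,d_0f$. $(T^\ast X,d_0)$ is independent of the choices up to essential isometry. **Forms.** $\Lambda^pT_x^\ast X$ carries the scalar product $\langle v_1\wedge\cdots\wedge v_p,w_1\wedge\cdots\wedge w_p\rangle=\det[(\langle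 v_i,w_j\rangle_{T_x^\ast X})_{i,j=1}^p]$, with completion $\hat\Lambda^pT_x^\ast X$; a section of $\hat\Lambda^pT^\ast X$ is measurable if its pairings with all $d_{0,x}f_1\wedge\cdots\wedge d_{0,x}f_p$, $f_i\in\mathcal{A}$, are measurable. For $p\ge1$, $\Omega^p(\mathcal{C})=\mathrm{span}\{g\,d_0f_1\wedge\cdots\wedge d_0f_p: f_i\in\mathcal{C},\ g\in\mathcal{C}\oplus\mathbb{R}\}\subset L^2(X,\hat\Lambda^pT^\ast X,\mu)$ ($\mu$-classes of sections). $\Omega^0(\mathcal{C}):=\mathcal{C}$ if $\mathcal{C}$ contains the constants and $\Omega^0(\mathcal{C}):=\mathcal{C}\oplus\mathbb{R}$ otherwise, with $d_0(f+c):=d_0f$ for constants $c$. For $p\ge1$, $d_p$ is defined by $d_p(g\,d_0f_1\wedge\cdots\wedge d_0f_p):=d_0g\wedge d_0f_1\wedge\cdots\wedge d_0f_p$ and extended to a linear map $d_p:\Omega^p(\mathcal{C})\to\Omega^{p+1}(\mathcal{C})$; $(\Omega^\ast(\mathcal{C}),d_\ast)$ is a cochain complex.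
   Formalization: If C lacks the constants, λ_0(f)=f cannot be onto Ω^0(C)=C⊕R; so surjectivity is stated for p≥1, and for p=0 when C contains the constants, with range of λ_0 equal to C in every case. Part (ii) is stated for any linear d_* satisfying its defining formula. *)

(* Defs.v *)
From HB Require Import structures.
From mathcomp Require Import all_boot all_order all_algebra perm ring_quotient.
From mathcomp Require Import all_classical all_reals all_analysis.
From mathcomp Require Import measurable_realfun.

Set Implicit Arguments.
Unset Strict Implicit.
Unset Printing Implicit Defensive.

Import Order.TTheory GRing.Theory Num.Theory.
Import numFieldNormedType.Exports.

Local Open Scope classical_set_scope.
Local Open Scope ring_scope.

Section linear_subspaces.
Variable R : realType.

Record linsub (V : lmodType R) := Linsub {
  linsub_set :> set V;
  linsub_subproof : linsub_set 0 /\
    forall a u v, linsub_set u -> linsub_set v -> linsub_set (a *: u + v) }.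

Definition linsub_pred (V : lmodType R) (S : linsub V) : {pred V} :=
  fun v => `[< linsub_set S v >].

Lemma linsub_submod_closed V (S : linsub V) : submod_closed (linsub_pred S).
Proof.
case: (linsub_subproof S) => S0 Slin; split; first exact/asboolP.
by move=> a u v /asboolP Su /asboolP Sv; apply/asboolP; exact: Slin.
Qed.

HB.instance Definition _ V (S : linsub V) :=
  GRing.isSubmodClosed.Build R V (linsub_pred S) (linsub_submod_closed S).

Section subspace_type.
Variables (V : lmodType R) (S : linsub V).

Definition subspaceType : Type := {v : V | linsub_pred S v}.
HB.instance Definition _ := SubChoice.on subspaceType.
HB.instance Definition _ := [SubChoice_isSubLmodule of subspaceType by <:].

Lemma subspace_valP (v : subspaceType) : linsub_set S (\val v).
Proof. by apply/asboolP; exact: (valP v). Qed.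

Definition subspace_Sub (v : V) (Sv : linsub_set S v) : subspaceType :=
  exist _ v (introT (asboolP _) Sv).

End subspace_type.

(* The additive group of V / S is the one of [ring_quotient]. *)
Section quotient_type.
Local Open Scope quotient_scope.
Variables (V : lmodType R) (S : linsub V).

Definition quotientType : Type := Quotient.quot (linsub_pred S).
HB.instance Definition _ := GRing.Zmodule.on quotientType.

Definition qclass (v : V) : quotientType := \pi_(Quotient.quot (linsub_pred S)) v.

Lemma qclass_eqP (u v : V) : qclass u = qclass v <-> linsub_set S (u - v).
Proof.
split=> [/eqP|] uv; last apply/eqP.
  by move: uv; rewrite -Quotient.idealrBE => /asboolP.
by rewrite -Quotient.idealrBE; apply/asboolP.
Qed.

Lemma qclass_repr (x : quotientType) : qclass (repr x) = x.
Proof. exact: reprK. Qed.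

Lemma qclassD u v : qclass (u + v) = qclass u + qclass v.
Proof. by rewrite /qclass !piE. Qed.

Definition qscale (a : R) (x : quotientType) : quotientType :=
  qclass (a *: repr x).

Lemma qclassZ a v : qclass (a *: v) = qscale a (qclass v).
Proof.
apply/qclass_eqP; rewrite -scalerBr.
have [S0 Slin] := linsub_subproof S.
rewrite -[_ *: _]addr0; apply: Slin => //.
by apply/qclass_eqP; rewrite qclass_repr.
Qed.

Lemma qscaleA a b x : qscale a (qscale b x) = qscale (a * b) x.
Proof. by rewrite -[x]qclass_repr -!qclassZ scalerA. Qed.

Lemma qscale1 : left_id 1 qscale.
Proof. by move=> x; rewrite -[x]qclass_repr -qclassZ scale1r. Qed.

Lemma qscaleDr : right_distributive qscale +%R.
Proof.
move=> a x y; rewrite -[x]qclass_repr -[y]qclass_repr.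
by rewrite -qclassD -!qclassZ -qclassD scalerDr.
Qed.

Lemma qscaleDl x : {morph qscale^~ x : a b / a + b}.
Proof.
by move=> a b /=; rewrite -[x]qclass_repr -!qclassZ -qclassD scalerDl.
Qed.

HB.instance Definition _ := GRing.Zmodule_isLmodule.Build R quotientType
  qscaleA qscale1 qscaleDr qscaleDl.

Lemma qclass_is_linear : linear qclass.
Proof. by move=> a u v; rewrite qclassD qclassZ. Qed.

HB.instance Definition _ :=
  GRing.isLinear.Build R V quotientType _ qclass qclass_is_linear.

End quotient_type.

Definition lspan_set (V : lmodType R) (A : set V) : set V :=
  [set v | exists n (a : 'I_n -> R) (s : 'I_n -> V),
    (forall i, A (s i)) /\ v = \sum_(i < n) a i *: s i].

Lemma lspan_subproof (V : lmodType R) (A : set V) : lspan_set A 0 /\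
  forall a u v, lspan_set A u -> lspan_set A v -> lspan_set A (a *: u + v).
Proof.
split; first by exists 0%N, (fun=> 0), (fun=> 0); rewrite big_ord0; split=> // -[].
move=> a u v [m [b [s [As ->]]]] [n [c [t [At ->]]]].
exists (m + n)%N, (fun i : 'I_(m + n) => match fintype.split i with inl k => a * b k | inr k => c k end),
  (fun i : 'I_(m + n) => match fintype.split i with inl k => s k | inr k => t k end).
split; first by move=> i; case: (fintype.split i).
rewrite big_split_ord scaler_sumr /=; congr (_ + _); apply: eq_bigr => i _.
  by rewrite (unsplitK (inl i : ('I_m + 'I_n)%type)) scalerA.
by rewrite (unsplitK (inr i : ('I_m + 'I_n)%type)).
Qed.
Definition lspan (V : lmodType R) (A : set V) := Linsub (lspan_subproof A).

Section images.
Variables (V W : lmodType R) (f : {linear V -> W}).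

Lemma limage_subproof (S : linsub V) : (f @` S) 0 /\
  forall a u v, (f @` S) u -> (f @` S) v -> (f @` S) (a *: u + v).
Proof.
have [S0 Slin] := linsub_subproof S.
split; first by exists 0 => //; rewrite linear0.
move=> a _ _ [u Su <-] [v Sv <-]; exists (a *: u + v); first exact: Slin.
by rewrite linearP.
Qed.
Definition limage S := Linsub (limage_subproof S).

Lemma lpreimage_subproof (S : linsub W) : (f @^-1` S) 0 /\
  forall a u v, (f @^-1` S) u -> (f @^-1` S) v -> (f @^-1` S) (a *: u + v).
Proof.
have [S0 Slin] := linsub_subproof S.
split; first by rewrite /preimage /= linear0.
by move=> a u v Su Sv; rewrite /preimage /= linearP; exact: Slin.
Qed.
Definition lpreimage S := Linsub (lpreimage_subproof S).

End images.

Lemma lzero_subproof (V : lmodType R) : [set 0 : V] 0 /\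
  forall a u v, [set 0 : V] u -> [set 0 : V] v -> [set 0 : V] (a *: u + v).
Proof. by split=> // a u v -> ->; rewrite scaler0 addr0. Qed.
Definition lzero (V : lmodType R) := Linsub (lzero_subproof V).

Lemma lfull_subproof (V : lmodType R) : [set: V] 0 /\
  forall a u v, [set: V] u -> [set: V] v -> [set: V] (a *: u + v).
Proof. by []. Qed.
Definition lfull (V : lmodType R) := Linsub (lfull_subproof V).

End linear_subspaces.

(* Cohomology ker d_p / im d_(p-1) of d_0, d_1, ... with d_(-1) = 0. *)
Section cohomology.
Variables (R : realType) (V : nat -> lmodType R).
Variable d : forall p, {linear V p -> V p.+1}.

Definition coboundaries p : linsub (V p) :=
  match p with
  | 0 => lzero (V 0%N)
  | q.+1 => limage (d q) (lfull (V q))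
  end.

Definition cocycle p : lmodType R := subspaceType (lpreimage (d p) (lzero _)).

Definition cohomology p : lmodType R :=
  quotientType (lpreimage (\val : {linear cocycle p -> V p}) (coboundaries p)).

Definition cohomology_class p (z : cocycle p) : cohomology p := qclass _ z.

End cohomology.

#[short(type="pmetricType")]
HB.structure Definition PointedMetric (K : numDomainType) :=
  {M of Pointed M & Metric K M}.

Definition borel (R : realType) (X : pmetricType R) :=
  g_sigma_algebraType (@open X).

Section spaces_and_measures.
Variables (R : realType) (X : pmetricType R).
Variable mu : {measure set (borel X) -> \bar R}.

Definition separable : Prop := exists2 S : set X, countable S & dense S.

Definition radon : Prop :=
  (forall K : set X, compact K -> (mu K < +oo)%E) /\
  (forall B : set (borel X), measurable B ->
    mu B = ereal_sup [set mu K | K in [set K : set X | compact K /\ K `<=` B]]).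

Definition full_support : Prop :=
  forall U : set X, open U -> U !=set0 -> (0 < mu U)%E.

Definition supp (f : X -> R) : set X := closure [set x | f x != 0].

Definition Cc : set (X -> R) := [set f | continuous f /\ compact (supp f)].

Definition bounded_function (f : X -> R) : Prop :=
  exists M : R, forall x, `|f x| <= M.

Definition Cb : set (X -> R) := [set f | continuous f /\ bounded_function f].

End spaces_and_measures.

(* Elements of L^2, and of form domains, are represented by functions; a
   domain is a set of functions saturated under a.e. equality. *)
Section dirichlet_forms.
Variables (R : realType) (X : pmetricType R).
Variable mu : {measure set (borel X) -> \bar R}.
Variables (D : set (X -> R)) (E : (X -> R) -> (X -> R) -> R).

Definition form_norm2 (f : X -> R) : R := E f f + \int[mu]_x (f x ^+ 2).

Record dirichlet_form : Prop := {
  df_L2 : forall f, D f -> f \in Lfun mu 2%:E ;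
  df_dom0 : D 0 ;
  df_domP : forall a f g, D f -> D g -> D (a *: f + g) ;
  df_dom_class : forall f g : X -> R, D f -> g \in Lfun mu 2%:E -> f = g %[ae mu] -> D g ;
  df_form_class : forall f g h, D f -> D g -> D h -> f = g %[ae mu] ->
    E f h = E g h ;
  df_formP : forall a f g h, D f -> D g -> D h ->
    E (a *: f + g) h = a * E f h + E g h ;
  df_sym : forall f g, D f -> D g -> E f g = E g f ;
  df_ge0 : forall f, D f -> 0 <= E f f ;
  df_dense : forall (f : X -> R) (e : R), f \in Lfun mu 2%:E -> 0 < e ->
    exists2 g, D g & ('N[mu]_2%:E[EFin \o (f - g)%R] < e%:E)%E ;
  df_closed : forall u : nat -> X -> R, (forall n, D (u n)) ->
    (forall e : R, 0 < e -> exists n0, forall m n, (n0 <= m)%N -> (n0 <= n)%N ->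
      form_norm2 (u m - u n) < e) ->
    exists2 v, D v & (fun n => form_norm2 (u n - v)) @ \oo --> (0 : R) ;
  df_markov : forall f, D f ->
    let h := fun x => Num.min (Num.max (f x) 0) 1 in D h /\ E h h <= E f f }.

Definition strongly_local : Prop :=
  forall f g, (@Cc R X `&` D) f -> (@Cc R X `&` D) g ->
    (exists2 U : set X, open U /\ supp f `<=` U &
       exists c, forall x, U x -> g x = c) ->
    E f g = 0.

Record regular : Prop := {
  regular_form : forall f (e : R), D f -> 0 < e ->
    exists2 g, (@Cc R X `&` D) g & form_norm2 (f - g) < e ;
  regular_sup : forall f (e : R), Cc f -> 0 < e ->
    exists2 g, (@Cc R X `&` D) g & forall x, `|f x - g x| <= e }.

Definition bdom : set (X -> R) := [set f | D f /\ bounded_function f].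

(* [cdc_continuous] is continuity on D x D, stated as boundedness of the
   bilinear map. *)
Record carre_du_champ (Gam : (X -> R) -> (X -> R) -> X -> R) : Prop := {
  cdc_L1 : forall f g, D f -> D g -> Gam f g \in Lfun mu 1 ;
  cdc_formula : forall f h, bdom f -> bdom h ->
    E (f * h) f - 2^-1 * E (f * f) h = \int[mu]_x (h x * Gam f f x) ;
  cdcP : forall a f g h, D f -> D g -> D h ->
    Gam (a *: f + g) h = a *: Gam f h + Gam g h %[ae mu] ;
  cdc_sym : forall f g, D f -> D g -> Gam f g = Gam g f %[ae mu] ;
  cdc_ge0 : forall f, D f -> {ae mu, forall x, 0 <= Gam f f x} ;
  cdc_continuous : exists K : R, forall f g, D f -> D g ->
    \int[mu]_x `|Gam f g x| <=
      K * Num.sqrt (form_norm2 f) * Num.sqrt (form_norm2 g) }.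

End dirichlet_forms.

Section nets.
Variables (Theta : Type) (le : Theta -> Theta -> Prop).

Record directed : Prop := {
  directed_inhabited : exists t : Theta, True ;
  directed_refl : forall s, le s s ;
  directed_trans : forall s t u, le s t -> le t u -> le s u ;
  directed_ub : forall s t, exists2 u, le s u & le t u }.

(* Convergence of a net is convergence along this filter. *)
Definition tails : set_system Theta :=
  [set A | exists s, [set t | le s t] `<=` A].

End nets.

Section kernels.
Variables (R : realType) (X : pmetricType R).
Variable mu : {measure set (borel X) -> \bar R}.

(* [j A] represents the class of x |-> j(x, A). *)
Record generalized_kernel (j : set X -> X -> \bar R) : Prop := {
  gk_measurable : forall A : set (borel X), measurable A ->
    measurable_fun [set: borel X] (j A : borel X -> \bar R) ;
  gk_ge0 : forall (A : set (borel X)) x, measurable A -> (0 <= j A x)%E ;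
  gk_measure : forall B : set (borel X), measurable B ->
    exists m : {measure set (borel X) -> \bar R},
      forall A : set (borel X), measurable A -> m A = (\int[mu]_(x in B) j A x)%E }.

(* The integral of F >= 0 against j(x,dy)mu(dx). A generalized kernel need not
   be a pointwise measure, so that only the masses int_B j(x,A) mu(dx) of
   rectangles B x A are available; as in Caratheodory's construction, the
   integral is the infimum over countable coverings by rectangles. If F is
   continuous, F 1_(B x X) has the same integral against every measure on X x X
   with these masses, and this is its value; if it is finite for B = X, the same
   holds for F 1_S with S any Borel subset of X x X. *)
Definition kernel_integral (j : set X -> X -> \bar R) (F : X -> X -> R) : \bar R :=
  ereal_inf [set s | exists (a : nat -> R) (B A : nat -> set (borel X)),
    [/\ forall k, 0 <= a k,
        forall k, measurable (B k) /\ measurable (A k),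
        forall x y, ((F x y)%:E <=
          \sum_(0 <= k <oo) (a k * \1_(B k) x * \1_(A k) y)%:E)%E &
        s = (\sum_(0 <= k <oo) ((a k)%:E * \int[mu]_(x in B k) j (A k) x))%E]].

(* G represents the class of x |-> int_X F(x,y) j(x,dy). *)
Definition kernel_fiber_integral (j : set X -> X -> \bar R) (F : X -> X -> R)
    (G : X -> \bar R) : Prop :=
  [/\ measurable_fun [set: borel X] (G : borel X -> \bar R),
      forall x, (0 <= G x)%E &
      forall B : set (borel X), measurable B ->
        (\int[mu]_(x in B) G x)%E =
        kernel_integral j (fun x y => \1_B x * F x y)].

Definition sqdiff (f : X -> R) (x y : X) : R := (f x - f y) ^+ 2.

Definition Gamma_theta (j : set X -> X -> \bar R) (f : X -> R) (G : X -> \bar R) :=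
  kernel_fiber_integral j (sqdiff f) G.

Variables (D : set (X -> R)) (E : (X -> R) -> (X -> R) -> R).
Variable Gam : (X -> R) -> (X -> R) -> X -> R.
Variables (Theta : Type) (le : Theta -> Theta -> Prop).
Variables (j : Theta -> set X -> X -> \bar R) (C : set (X -> R)).

Record kernel_conditions : Prop := {
  kc_sym : forall t (A B : set (borel X)), measurable A -> measurable B ->
    (\int[mu]_(x in B) j t A x = \int[mu]_(x in A) j t B x)%E ;
  kc_dense_form : forall f (e : R), D f -> 0 < e ->
    exists2 g, C g & form_norm2 mu E (f - g) < e ;
  kc_dense_L1 : forall (f : X -> R) (e : R), f \in Lfun mu 1 -> 0 < e ->
    exists2 g, C g & ('N[mu]_1[EFin \o (f - g)%R] < e%:E)%E ;
  kc_energy : forall f, C f -> exists G : Theta -> X -> \bar R,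
    [/\ forall t, Gamma_theta (j t) f (G t),
        forall t, mu.-integrable [set: borel X] (G t) &
        (\int[mu]_x G t x)%E @[t --> tails le] --> (E f f)%:E] ;
  kc_local : exists2 e0 : R, 0 < e0 & forall e : R, 0 < e < e0 ->
    forall f, C f ->
    kernel_integral (j t) (fun x y => \1_(~` ball x e) y * sqdiff f x y)
      @[t --> tails le] --> 0%E }.

Record gradient_bound : Prop := {
  gb_Gam : forall f, C f -> Gam f f \in Lfun mu +oo%E ;
  gb_kernel : forall f, C f ->
    (ereal_sup [set 'N[mu]_+oo[G] | G in
      [set G | exists t, Gamma_theta (j t) f G]] < +oo)%E }.

End kernels.

(* Subalgebras (not necessarily unital) of the algebra of functions. *)
Record subalgebra (R : realType) (X : Type) := Subalgebra {
  subalgebra_sub :> linsub (X -> R : lmodType R) ;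
  subalgebraM : forall f g, linsub_set subalgebra_sub f ->
    linsub_set subalgebra_sub g -> linsub_set subalgebra_sub (f * g) }.

Definition with_constants (R : realType) (X : Type) (C : set (X -> R)) :
    set (X -> R) :=
  [set g | exists h c, C h /\ g = h + cst c].

(* [gcons g f] is the list g, f_0, ..., f_(n-1). *)
Definition gcons (T : Type) n (g : T) (f : 'I_n -> T) (i : 'I_n.+1) : T :=
  if unlift ord0 i is Some k then f k else g.

Record diagonal_nbhds (R : realType) (X : pmetricType R) := DiagonalNbhds {
  diag_nbhd :> forall p, set ('I_p.+1 -> X) ;
  diag_open : forall p, open (@diag_nbhd p : set {ptws 'I_p.+1 -> X}) ;
  diag_mem : forall p x, @diag_nbhd p (fun=> x) ;
  diag_perm : forall p (s : 'S_p.+1) x, @diag_nbhd p x -> @diag_nbhd p (x \o s) ;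
  diag_face : forall p (i : 'I_p.+2) x, @diag_nbhd p.+1 x ->
    @diag_nbhd p (x \o lift i) }.
Arguments diag_nbhd {R X} _ _ _.

(* Functions of n variables are functions on 'I_n -> X. The operator [delta n]
   maps functions of n variables to functions of n + 1 variables; in the
   indexing of cochains by degree it is delta_(n-1). *)
Section nonlocal_complex.
Variables (R : realType) (X : pmetricType R).
Local Notation fn n := (('I_n -> X) -> R).

Definition Alt n (F : fn n) : fn n := fun x =>
  (n`!%:R)^-1 * \sum_(s : 'S_n) (-1) ^+ s * F (x \o s).

Definition tensor n (f : 'I_n -> X -> R) : fn n :=
  fun x => \prod_(i < n) f i (x i).

Definition delta n (F : fn n) : fn n.+1 :=
  fun x => \sum_(i < n.+1) (-1) ^+ i * F (x \o lift i).

Definition average n (g : X -> R) : fn n.+1 :=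
  fun x => (n.+1%:R)^-1 * \sum_(i < n.+1) g (x i).

Definition restrictN n (A : set ('I_n -> X)) (F : fn n) : fn n := F \_ A.

Lemma delta_is_linear n : linear (@delta n).
Proof.
move=> a F G; apply/funext => x; rewrite /delta !(addrfctE, scalrfctE) /=.
rewrite scaler_sumr -big_split; apply: eq_bigr => i _ /=.
by rewrite mulrDr; congr (_ + _); exact: mulrCA.
Qed.
HB.instance Definition _ n := GRing.isLinear.Build R (fn n) (fn n.+1) _
  (@delta n) (@delta_is_linear n).

Lemma restrictN_is_linear n A : linear (@restrictN n A).
Proof.
move=> a F G; apply/funext => x.
rewrite /restrictN !(addrfctE, scalrfctE) /= !patchE.
by case: ifP => // _; rewrite scaler0 addr0.
Qed.
HB.instance Definition _ n A := GRing.isLinear.Build R (fn n) (fn n) _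
  (@restrictN n A) (@restrictN_is_linear n A).

End nonlocal_complex.

Section nonlocal_cochains.
Variables (R : realType) (X : pmetricType R).
Local Notation fn n := (('I_n -> X) -> R).

Lemma Alt_tensorE n (f : 'I_n -> X -> R) (x : 'I_n -> X) :
  Alt (tensor f) x = (n`!%:R)^-1 * \det (\matrix_(i, j) f i (x j)).
Proof.
congr (_ * _); apply: eq_bigr => s _; congr (_ * _).
by apply: eq_bigr => i _; rewrite mxE.
Qed.

Lemma gcons0 T n (g : T) (f : 'I_n -> T) : gcons g f ord0 = g.
Proof. by rewrite /gcons unlift_none. Qed.

Lemma gconsS T n (g : T) (f : 'I_n -> T) i : gcons g f (lift ord0 i) = f i.
Proof. by rewrite /gcons liftK. Qed.

Lemma delta_Alt_tensor n (f : 'I_n -> X -> R) :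
  delta (Alt (tensor f)) = n.+1%:R *: Alt (tensor (gcons (cst 1) f)).
Proof.
apply/funext => x; rewrite scalrfctE Alt_tensorE.
rewrite [RHS]mulrA factS natrM invfM mulrA mulfV ?pnatr_eq0// mul1r.
rewrite (expand_det_row _ ord0) mulr_sumr; apply: eq_bigr => j _.
rewrite mxE gcons0 mul1r Alt_tensorE mulrCA; congr (_ * _).
rewrite /cofactor add0n; congr (_ * _); congr (\det _).
by apply/matrixP => k l; rewrite !mxE gconsS.
Qed.

(* Restrictions to N_p are represented as functions extended by 0 off N_p. *)
Variables (C : subalgebra R X) (N : diagonal_nbhds X).

Definition cochain_generators p : set (fn p.+1) :=
  [set F | exists f : 'I_p.+1 -> X -> R,
    [/\ (if p is 0 then linsub_set C else with_constants C) (f ord0),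
        forall i : 'I_p, linsub_set C (f (lift ord0 i)) &
        F = Alt (tensor f)]].
Arguments cochain_generators p _ : clear implicits.

Definition global_cochains p : linsub (fn p.+1 : lmodType R) :=
  lspan (cochain_generators p).

Definition cochains_sub p : linsub (fn p.+1 : lmodType R) :=
  limage (@restrictN R X p.+1 (N p)) (global_cochains p).

Definition cochains p : lmodType R := subspaceType (cochains_sub p).

Lemma Alt_tensor_shift n (h : X -> R) (c : R) (f : 'I_n -> X -> R) :
  Alt (tensor (gcons (cst 1) (gcons (h + cst c) f))) =
  Alt (tensor (gcons (cst 1) (gcons h f))).
Proof.
apply/funext => x; rewrite !Alt_tensorE; congr (_ * _).
pose M g := \matrix_(i, j) gcons (cst 1) (gcons g f) i (x j).
have MS g k : M g (lift ord0 k) = fun j => gcons g f k (x j).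
  by apply/funext => j; rewrite mxE gconsS.
rewrite (@determinant_multilinear _ _ (M (h + cst c)) (M h) (M (cst 1))
  (lift ord0 ord0) 1 c).
- rewrite mul1r [X in _ + _ * X](@determinant_alternate _ _ _ ord0 (lift ord0 ord0)) ?mulr0 ?addr0//.
  by move=> j; rewrite MS mxE !gcons0.
- by apply/rowP => j; rewrite !mxE !gconsS !gcons0 mul1r mulr1.
- apply/matrixP => k j; rewrite !mxE.
  case: (unliftP ord0 (lift (lift ord0 ord0) k)) => [l El|->]; last by rewrite !gcons0.
  rewrite El !gconsS; case: (unliftP ord0 l) => [m ->|l0]; first by rewrite !gconsS.
  by have := neq_lift (lift ord0 ord0) k; rewrite El l0 eqxx.
- apply/matrixP => k j; rewrite !mxE.
  case: (unliftP ord0 (lift (lift ord0 ord0) k)) => [l El|->]; last by rewrite !gcons0.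
  rewrite El !gconsS; case: (unliftP ord0 l) => [m ->|l0]; first by rewrite !gconsS.
  by have := neq_lift (lift ord0 ord0) k; rewrite El l0 eqxx.
Qed.

Lemma gcons_eta T n (f : 'I_n.+1 -> T) :
  f = gcons (f ord0) (fun i => f (lift ord0 i)).
Proof.
apply/funext => i; case: (unliftP ord0 i) => [k ->|->];
  by rewrite ?gconsS ?gcons0.
Qed.

Lemma cochain_generators_delta p F : cochain_generators p F ->
  exists2 G, cochain_generators p.+1 G & delta F = p.+2%:R *: G.
Proof.
have [C0 CP] := linsub_subproof C.
move=> [f [f0 fC ->]]; rewrite delta_Alt_tensor.
have [h [c [Ch Ef0]]] : with_constants C (f ord0).
  by case: p {F fC} f f0 => // f f0; exists (f ord0), 0; rewrite addr0.
pose f' := gcons h (fun i => f (lift ord0 i)).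
exists (Alt (tensor (gcons (cst 1) f'))); last first.
  by rewrite [f]gcons_eta Ef0 Alt_tensor_shift.
exists (gcons (cst 1) f'); split=> //.
  by rewrite gcons0; exists 0, 1; rewrite add0r.
move=> i; rewrite gconsS /f'; case: (unliftP ord0 i) => [k ->|->];
  by rewrite ?gconsS ?gcons0.
Qed.

Lemma global_cochains_delta p F : linsub_set (global_cochains p) F ->
  linsub_set (global_cochains p.+1) (delta F).
Proof.
move=> [n [a [s [sC ->]]]].
have /choice[t st] i : exists G, cochain_generators p.+1 G /\
    delta (s i) = p.+2%:R *: G.
  by have [G CG EG] := cochain_generators_delta (sC i); exists G.
exists n, (fun i => a i * p.+2%:R), t; split=> [i|]; first exact: (st i).1.
rewrite linear_sum; apply: eq_bigr => i _ /=.
by rewrite linearZ /= (st i).2 scalerA.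
Qed.

Lemma delta_restrictN p (F : fn p.+1) :
  restrictN (N p.+1) (delta (restrictN (N p) F)) = restrictN (N p.+1) (delta F).
Proof.
apply/funext => x; rewrite /restrictN !patchE; case: ifPn => // /set_mem Nx.
apply: eq_bigr => i _; rewrite patchE mem_set//; exact: diag_face.
Qed.

Definition cochain_delta_fun p (F : cochains p) : fn p.+2 :=
  restrictN (N p.+1) (delta (\val F)).

Lemma cochain_delta_subproof p (F : cochains p) :
  linsub_set (cochains_sub p.+1) (cochain_delta_fun F).
Proof.
have [G CG FE] := subspace_valP F.
exists (delta G); first exact: global_cochains_delta.
by rewrite /cochain_delta_fun -FE delta_restrictN.
Qed.

Definition cochain_delta p (F : cochains p) : cochains p.+1 :=
  subspace_Sub (cochain_delta_subproof F).

Lemma cochain_delta_is_linear p : linear (@cochain_delta p).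
Proof. by move=> a F G; apply/val_inj; rewrite /= /cochain_delta_fun !linearP. Qed.
HB.instance Definition _ p := GRing.isLinear.Build R (cochains p) (cochains p.+1) _
  (@cochain_delta p) (@cochain_delta_is_linear p).

Definition cochain_differential p : {linear cochains p -> cochains p.+1} :=
  @cochain_delta p.

End nonlocal_cochains.
Arguments cochain_differential {R X} C N p.

Record hilbert (R : realType) := Hilbert {
  hilbert_car :> completeNormedModType R ;
  dotp : hilbert_car -> hilbert_car -> R ;
  dotpC : forall u v, dotp u v = dotp v u ;
  dotpP : forall a u v w, dotp (a *: u + v) w = a * dotp u w + dotp v w ;
  dotp_norm : forall u, dotp u u = `|u| ^+ 2 }.

Section sections.
Variables (R : realType) (X : Type) (H : X -> lmodType R).

Definition sections : Type := forall x, H x.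
HB.instance Definition _ := Choice.on sections.

Let add (s t : sections) : sections := fun x => s x + t x.
Let opp (s : sections) : sections := fun x => - s x.
Let zero : sections := fun x => 0.
Let scale (a : R) (s : sections) : sections := fun x => a *: s x.

Let addA : associative add.
Proof. by move=> r s t; apply: functional_extensionality_dep => x; exact: addrA. Qed.
Let addC : commutative add.
Proof. by move=> s t; apply: functional_extensionality_dep => x; exact: addrC. Qed.
Let add0 : left_id zero add.
Proof. by move=> s; apply: functional_extensionality_dep => x; exact: add0r. Qed.
Let addN : left_inverse zero opp add.
Proof. by move=> s; apply: functional_extensionality_dep => x; exact: addNr. Qed.
HB.instance Definition _ := GRing.isZmodule.Build sections addA addC add0 addN.

Let scaleA a b s : scale a (scale b s) = scale (a * b) s.
Proof. by apply: functional_extensionality_dep => x; exact: scalerA. Qed.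
Let scale1 : left_id 1 scale.
Proof. by move=> s; apply: functional_extensionality_dep => x; exact: scale1r. Qed.
Let scaleDr : right_distributive scale +%R.
Proof. by move=> a s t; apply: functional_extensionality_dep => x; exact: scalerDr. Qed.
Let scaleDl s : {morph scale^~ s : a b / a + b}.
Proof. by move=> a b; apply: functional_extensionality_dep => x; exact: scalerDl. Qed.
HB.instance Definition _ := GRing.Zmodule_isLmodule.Build R sections
  scaleA scale1 scaleDr scaleDl.

Lemma sections_addE (s t : sections) x : (s + t) x = s x + t x.
Proof. by []. Qed.

Lemma sections_scaleE a (s : sections) x : (a *: s) x = a *: s x.
Proof. by []. Qed.

End sections.

Section section_classes.
Variables (R : realType) (X : pmetricType R).
Variable mu : {measure set (borel X) -> \bar R}.
Variable H : X -> lmodType R.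

Definition ae_zero : set (sections H) := [set s | {ae mu, forall x, s x = 0}].

Lemma ae_zero_subproof : ae_zero 0 /\
  forall a u v, ae_zero u -> ae_zero v -> ae_zero (a *: u + v).
Proof.
split; first exact: aeW.
move=> a u v; apply: filterS2 => x u0 v0.
by rewrite sections_addE sections_scaleE u0 v0 scaler0 addr0.
Qed.

Definition section_classes : lmodType R :=
  quotientType (Linsub ae_zero_subproof).

Definition section_class (s : sections H) : section_classes := qclass _ s.

End section_classes.

Section first_order.
Variables (R : realType) (X : pmetricType R).
Variable mu : {measure set (borel X) -> \bar R}.
Variables (D : set (X -> R)) (E : (X -> R) -> (X -> R) -> R).
Variables (Gam : (X -> R) -> (X -> R) -> X -> R) (C : set (X -> R)).

(* [cot x] is T*_x X and [d0x x] the map d_(0,x) on the span of [phi]: it is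
   the Hilbert completion of that span modulo the kernel of the seminorm,
   which is determined by [fo_d0x_dot] and [fo_d0x_dense]. Sections are
   represented pointwise; the class of [d0 f] is determined by [fo_d0P],
   [fo_d0_extends] and [fo_d0_norm]. *)
Record first_order_structure := FirstOrderStructure {
  phi : nat -> X -> R ;
  fo_phiC : forall k, C (phi k) ;
  fo_dense : forall f (e : R), bdom D f -> 0 < e ->
    exists2 u, linsub_set (lspan (range phi)) u & E (f - u) (f - u) < e ;
  Gamt : (X -> R) -> (X -> R) -> X -> R ;
  fo_Gamt_version : forall i k,
    measurable_fun [set: borel X] (Gamt (phi i) (phi k) : borel X -> R) /\
    Gamt (phi i) (phi k) = Gam (phi i) (phi k) %[ae mu] ;
  fo_Gamt_sym : forall i k x, Gamt (phi i) (phi k) x = Gamt (phi k) (phi i) x ;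
  fo_Gamt_ge0 : forall n x (a : 'I_n -> R),
    0 <= \sum_(i < n) \sum_(k < n) a i * a k * Gamt (phi i) (phi k) x ;
  fo_GamtPl : forall a u v w, linsub_set (lspan (range phi)) u ->
    linsub_set (lspan (range phi)) v -> linsub_set (lspan (range phi)) w ->
    Gamt (a *: u + v) w = a *: Gamt u w + Gamt v w ;
  fo_GamtPr : forall a u v w, linsub_set (lspan (range phi)) u ->
    linsub_set (lspan (range phi)) v -> linsub_set (lspan (range phi)) w ->
    Gamt w (a *: u + v) = a *: Gamt w u + Gamt w v ;
  cot : X -> hilbert R ;
  d0x : forall x, (X -> R) -> cot x ;
  fo_d0xP : forall x a u v, linsub_set (lspan (range phi)) u ->
    linsub_set (lspan (range phi)) v ->
    d0x x (a *: u + v) = a *: d0x x u + d0x x v ;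
  fo_d0x_dot : forall x u v, linsub_set (lspan (range phi)) u ->
    linsub_set (lspan (range phi)) v ->
    dotp (d0x x u) (d0x x v) = Gamt u v x ;
  fo_d0x_dense : forall x, dense (d0x x @` lspan (range phi)) ;
  d0 : (X -> R) -> forall x, cot x ;
  fo_d0_measurable : forall f u, bdom D f ->
    linsub_set (lspan (range phi)) u ->
    measurable_fun [set: borel X]
      ((fun x => dotp (d0 f x) (d0x x u)) : borel X -> R) ;
  fo_d0P : forall a f g, bdom D f -> bdom D g ->
    {ae mu, forall x, d0 (a *: f + g) x = a *: d0 f x + d0 g x} ;
  fo_d0_extends : forall u, linsub_set (lspan (range phi)) u ->
    {ae mu, forall x, d0 u x = d0x x u} ;
  fo_d0_norm : forall f, bdom D f ->
    (\int[mu]_x (`|d0 f x| ^+ 2)%:E = (E f f)%:E)%E ;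
  fo_d0_dot : forall f g, bdom D f -> bdom D g ->
    {ae mu, forall x, dotp (d0 f x) (d0 g x) = Gam f g x} ;
  fo_d0_leibniz : forall f g, bdom D f -> bdom D g ->
    {ae mu, forall x, d0 (f * g) x = f x *: d0 g x + g x *: d0 f x} }.

End first_order.

(* L is the Hilbert space completion of the p-th exterior power of H, with
   decomposable elements [w v] = v_0 /\ ... /\ v_(p-1). *)
Record exterior_power (R : realType) (H : hilbert R) p (L : hilbert R)
    (w : ('I_p -> H) -> L) : Prop := {
  ext_multilinear : forall (i : 'I_p) a (u v : H) (f : 'I_p -> H),
    w (fun k => if k == i then a *: u + v else f k) =
    a *: w (fun k => if k == i then u else f k) +
    w (fun k => if k == i then v else f k) ;
  ext_alternating : forall (f : 'I_p -> H) i k, i != k -> f i = f k -> w f = 0 ;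
  ext_dot : forall v u : 'I_p -> H,
    dotp (w v) (w u) = \det (\matrix_(i, k) dotp (v i) (u k)) ;
  ext_dense : dense (linsub_set (lspan (range w))) }.

Record exterior_bundle (R : realType) (X : Type) (H : X -> hilbert R) :=
    ExteriorBundle {
  ext : nat -> X -> hilbert R ;
  wedge : forall p x, ('I_p -> H x) -> ext p x ;
  wedgeP : forall p x, exterior_power (@wedge p x) }.

Section forms.
Variables (R : realType) (X : pmetricType R).
Variable mu : {measure set (borel X) -> \bar R}.
Variables (D : set (X -> R)) (E : (X -> R) -> (X -> R) -> R).
Variables (Gam : (X -> R) -> (X -> R) -> X -> R) (C : subalgebra R X).
Variable FO : first_order_structure mu D E Gam C.
Variable Lam : exterior_bundle (cot FO).

(* Forms of degree 0 are functions, those of degree p >= 1 are mu-classes of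
   sections of the p-th exterior power. *)
Definition form_space p : lmodType R :=
  match p with
  | 0 => (X -> R : lmodType R)
  | q.+1 => section_classes mu (fun x => ext Lam q.+1 x : lmodType R)
  end.

(* g d_0 f_1 /\ ... /\ d_0 f_p *)
Definition simple_form p : (X -> R) -> ('I_p -> X -> R) -> form_space p :=
  match p with
  | 0 => fun g _ => g
  | q.+1 => fun g f => section_class mu
      (fun x => g x *: wedge Lam (fun i => d0 FO (f i) x))
  end.

(* In degree 0 this is C + R, which is C if C contains the constants. *)
Definition forms_sub p : linsub (form_space p) :=
  lspan [set w | exists g (f : 'I_p -> X -> R),
    [/\ with_constants C g, forall i, linsub_set C (f i) & w = simple_form g f]].

Definition forms p : lmodType R := subspaceType (forms_sub p).

(* d_p (g d_0 f_1 /\ ... /\ d_0 f_p) = d_0 g /\ d_0 f_1 /\ ... /\ d_0 f_p, where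
   d_0 (h + c) = d_0 h for h in C and c constant. *)
Definition exterior_derivative (d : forall p, {linear forms p -> forms p.+1}) :=
  forall p (w : forms p) (h : X -> R) (c : R) (f : 'I_p -> X -> R),
    linsub_set C h -> (forall i, linsub_set C (f i)) ->
    \val w = simple_form (h + cst c) f ->
    \val (d p w) = simple_form (cst 1) (gcons h f).

Variable N : diagonal_nbhds X.

Definition is_lambda (lam : forall p, {linear cochains C N p -> forms p}) :=
  (forall (F : cochains C N 0%N) (f : X -> R), linsub_set C f ->
     \val F = restrictN (N 0%N) (fun x => f (x ord0)) ->
     \val (lam 0%N F) = f) /\
  (forall p (F : cochains C N p.+1) n (g : 'I_n -> X -> R)
     (f : 'I_n -> 'I_p.+1 -> X -> R),
     (forall i, with_constants C (g i)) ->
     (forall i k, linsub_set C (f i k)) ->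
     \val F = restrictN (N p.+1)
       (\sum_(i < n) average (g i) * delta (Alt (tensor (f i)))) ->
     \val (lam p.+1 F) = \sum_(i < n) simple_form (g i) (f i)).

End forms.

(* Main.v *)
Require Import Defs.
From HB Require Import structures.
From mathcomp Require Import all_boot all_order all_algebra.
From mathcomp Require Import perm ring lra.
From mathcomp Require Import all_classical all_reals all_analysis.
From mathcomp Require Import measurable_realfun.

Set Implicit Arguments.
Unset Strict Implicit.
Unset Printing Implicit Defensive.

Import Order.TTheory GRing.Theory Num.Theory.
Import numFieldNormedType.Exports.

Local Open Scope classical_set_scope.
Local Open Scope ring_scope.

(* Write F = \sum_i avg(g_i) delta Alt(f_i) and suppose that F vanishes on N_p.
   Near a point z choose an open U with U^(p+1) inside N_p. The functions f_ik,
   g_i, g_i f_ik and 1 span a finite-dimensional space on U, so there are points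
   y_l of U such that every u in this span is \sum_l u(y_l) e_l on U. The
   differential is local: multiplying by a cutoff function and using the Leibniz
   rule shows that d_0 u = 0 wherever u vanishes on an open set; hence
   d_0 u = \sum_l u(y_l) d_0 e_l near z as well. Pairing the values
   F(x, y_(l_1), ..., y_(l_p)) = 0 with d_0 e_(l_1) /\ ... /\ d_0 e_(l_p) thus
   amounts to differentiating F in its last p variables on the diagonal, and since
   delta Alt(f)(x, y) = det(f_k(y_l) - f_k(x)) / p!, the result is
   \sum_i g_i d_0 f_i1 /\ ... /\ d_0 f_ip = 0 almost everywhere near z, so that
   lambda_p is well defined. The rest is the identity between tensors
   avg(g) delta Alt(f_1 ... f_p) =
   Alt(g f_1 ... f_p) + \sum_k Alt(1 f_1 ... (g f_k) ... f_p). *)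

Section multilinear_maps.
Variables (R : realType) (H L : lmodType R).

Definition multilinear p (w : ('I_p -> H) -> L) : Prop :=
  forall (i : 'I_p) a (u v : H) (f : 'I_p -> H),
    w (fun k => if k == i then a *: u + v else f k) =
    a *: w (fun k => if k == i then u else f k) +
    w (fun k => if k == i then v else f k).

Lemma gcons_if p (u : H) (f : 'I_p -> H) :
  gcons u f = fun k => if k == ord0 then u else gcons 0 f k.
Proof.
apply/funext => k; case: (unliftP ord0 k) => [l ->|->].
  by rewrite !gconsS eq_sym (negbTE (neq_lift _ _)).
by rewrite gcons0 eqxx.
Qed.

Lemma multilinear_gcons_head p (w : ('I_p.+1 -> H) -> L) f a u v :
  multilinear w ->
  w (gcons (a *: u + v) f) = a *: w (gcons u f) + w (gcons v f).
Proof. by move=> wP; rewrite gcons_if wP -!gcons_if. Qed.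

Lemma multilinear_gcons_tail p (w : ('I_p.+1 -> H) -> L) u :
  multilinear w -> multilinear (fun f => w (gcons u f)).
Proof.
move=> wP i a v1 v2 f.
have E v : gcons u (fun k => if k == i then v else f k) =
    fun k => if k == lift ord0 i then v else gcons u f k.
  apply/funext => k; case: (unliftP ord0 k) => [l ->|->].
    by rewrite !gconsS (inj_eq (@lift_inj _ _)).
  by rewrite !gcons0 (negbTE (neq_lift _ _)).
by rewrite !E wP.
Qed.

Lemma multilinear_gcons_sum p (w : ('I_p.+1 -> H) -> L) f n
    (c : 'I_n -> R) (e : 'I_n -> H) : multilinear w ->
  w (gcons (\sum_l c l *: e l) f) = \sum_l c l *: w (gcons (e l) f).
Proof.
move=> wP.
have w0 : w (gcons 0 f) = 0.
  have := multilinear_gcons_head f (-1) 0 0 wP.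
  by rewrite scaler0 addr0 scaleN1r addNr.
elim/big_rec2: _ => [//|l y z _ IH].
by rewrite multilinear_gcons_head// IH.
Qed.

Lemma multilinear_scale p (w : ('I_p -> H) -> L) i a f : multilinear w ->
  w (fun k => (if k == i then a else 1) *: f k) = a *: w f.
Proof.
move=> wP; have w0 : w (fun k => if k == i then 0 else f k) = 0.
  have := wP i (-1) 0 0 f.
  by rewrite scaler0 addr0 scaleN1r addNr.
have := wP i a (f i) 0 f; rewrite w0 !addr0.
rewrite (_ : (fun k => if k == i then f i else f k) = f); last first.
  by apply/funext => k; case: eqP => [->|].
by move=> <-; congr (w _); apply/funext => k; case: eqP => [->|]; rewrite ?scale1r.
Qed.

(* The tensor with values [\sum_m a m * \prod_k c m k (l k)] being zero, so is
   its image under the linearization of [w]. Induction on the number of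
   variables avoids expanding [w] over all multi-indices. *)
Lemma multilinear_tensor_eq0 p (w : ('I_p -> H) -> L) n (e : 'I_n -> H)
    (M : finType) (a : M -> R) (c : M -> 'I_p -> 'I_n -> R) :
  multilinear w ->
  (forall l : 'I_p -> 'I_n, \sum_m a m * \prod_k c m k (l k) = 0) ->
  \sum_m a m *: w (fun k => \sum_l c m k l *: e l) = 0.
Proof.
elim: p w a c => [|p IH] w a c wP ac0.
  have E m : a m *: w (fun k => \sum_l c m k l *: e l) = a m *: w (fun=> 0).
    by congr (_ *: w _); apply/funext => -[].
  have l0 : 'I_0 -> 'I_n by case.
  have := ac0 l0; under eq_bigr do rewrite big_ord0 mulr1.
  by move=> a0; under eq_bigr do rewrite E; rewrite -scaler_suml a0 scale0r.
have E m : a m *: w (fun k => \sum_l c m k l *: e l) =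
    \sum_l (a m * c m ord0 l) *: w (gcons (e l)
      (fun k => \sum_l c m (lift ord0 k) l *: e l)).
  rewrite [X in w X]gcons_eta multilinear_gcons_sum// scaler_sumr.
  by apply: eq_bigr => l _; rewrite scalerA.
under eq_bigr do rewrite E.
rewrite exchange_big big1//= => l _.
apply: (IH (fun f => w (gcons (e l) f)) (fun m => a m * c m ord0 l)
  (fun m k => c m (lift ord0 k))); first exact: multilinear_gcons_tail.
move=> l'; rewrite -[RHS](ac0 (gcons l l')); apply: eq_bigr => m _.
rewrite big_ord_recl gcons0 mulrA; congr (_ * _).
by apply: eq_bigr => k _; rewrite gconsS.
Qed.

End multilinear_maps.

(* Points where the matrix of values has maximal rank determine every function
   of the span of [h] on [U]. *)
Lemma interpolation (R : realType) (X : Type) (U : set X) (J : finType)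
    (h : J -> X -> R) :
  exists n (z : 'I_n -> X) (b : 'I_n -> J -> R), (forall l, U (z l)) /\
    forall x j, U x -> h j x = \sum_l h j (z l) * (\sum_i b l i * h i x).
Proof.
pose ev x : 'rV[R]_#|J| := \row_m h (enum_val m) x.
pose mx n (z : 'I_n -> X) := \matrix_(l < n) ev (z l).
pose P r := `[< exists n (z : 'I_n -> X),
  (forall l, U (z l)) /\ \rank (mx n z) = r >].
have exP : exists r, P r.
  have z0 : 'I_0 -> X by case.
  by exists (\rank (mx 0%N z0)); apply/asboolP; exists 0%N, z0; split=> // -[].
have boundP r : P r -> (r <= #|J|)%N.
  by move=> /asboolP[n [z [_ <-]]]; exact: rank_leq_col.
case: (ex_maxnP exP boundP) => r /asboolP[n [z [Uz rz]]] maxr.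
exists n, z, (fun l i => pinvmx (mx n z) (enum_rank i) l); split=> // x j Ux.
have : (ev x <= mx n z)%MS.
  have S : (mx n z <= col_mx (mx n z) (ev x))%MS.
    by rewrite -addsmxE addsmxSl.
  apply: (submx_trans (_ : ev x <= col_mx (mx n z) (ev x))%MS).
    by rewrite -addsmxE addsmxSr.
  rewrite -(mxrank_leqif_sup S) eqn_leq mxrankS//= rz.
  apply: maxr; apply/asboolP; exists (n + 1)%N,
    (fun l => match fintype.split l with inl k => z k | inr _ => x end).
  split=> [l|]; first by case: (fintype.split l).
  congr (\rank _); apply/row_matrixP => l; rewrite rowK.
  rewrite -(splitK l); case: (fintype.split l) => k /=.
    by rewrite (unsplitK (inl k)) rowKu rowK.
  by rewrite (unsplitK (inr k)) rowKd ord1 row_id.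
move=> /mulmxKpV/rowP/(_ (enum_rank j)); rewrite !mxE enum_rankK => <-.
apply: eq_bigr => l _; rewrite !mxE enum_rankK mulrC; congr (_ * _).
rewrite [RHS](reindex (fun m : 'I_#|J| => enum_val m)) /=; last first.
  exact: (onW_bij _ (enum_val_bij J)).
by apply: eq_bigr => i _; rewrite mxE enum_valK mulrC.
Qed.

Section alternated_tensors.
Variables (R : realType) (X : pmetricType R).
Local Notation fn n := (('I_n -> X) -> R).

Lemma sum_mul_Alt_tensor n (g : X -> R) (f : 'I_n -> X -> R) x :
  (\sum_j g (x j)) * Alt (tensor f) x =
  \sum_r Alt (tensor (fun i => if i == r then g * f i else f i)) x.
Proof.
rewrite /Alt -mulr_sumr mulrCA; congr (_ * _).
rewrite exchange_big mulr_sumr /=; apply: eq_bigr => s _.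
rewrite -mulr_sumr mulrCA; congr (_ * _).
rewrite (reindex_inj (@perm_inj _ s)) mulr_suml /=; apply: eq_bigr => r _.
rewrite /tensor [in RHS](bigD1 r)//= eqxx (bigD1 r)//= mulrA; congr (_ * _).
by apply: eq_bigr => i /negbTE ->.
Qed.

Lemma average_delta_Alt p (g : X -> R) (f : 'I_p -> X -> R) :
  average g * delta (Alt (tensor f)) = Alt (tensor (gcons g f)) +
  \sum_k Alt (tensor (gcons (cst 1) (fun i => if i == k then g * f i else f i))).
Proof.
apply/funext => x; rewrite delta_Alt_tensor [LHS]/GRing.mul/= /average.
rewrite [X in _ * X]/GRing.scale/= mulrACA mulVf ?pnatr_eq0// mul1r.
rewrite sum_mul_Alt_tensor big_ord_recl addrfctE fct_sumE; congr (_ + _).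
  congr (Alt (tensor _) x); apply/funext => i.
  case: (unliftP ord0 i) => [k ->|->]; last by rewrite !gcons0 eqxx mulr1.
  by rewrite eq_sym (negbTE (neq_lift _ _)) !gconsS.
apply: eq_bigr => r _; congr (Alt (tensor _) x); apply/funext => i.
case: (unliftP ord0 i) => [k ->|->].
  by rewrite (inj_eq (@lift_inj _ _)) !gconsS.
by rewrite (negbTE (neq_lift _ _)) !gcons0.
Qed.

(* Subtracting the first column from the others. *)
Lemma delta_Alt_base p (f : 'I_p -> X -> R) (x : 'I_p.+1 -> X) :
  delta (Alt (tensor f)) x = (p`!%:R)^-1 *
    \det (\matrix_(i, j) (f i (x (lift ord0 j)) - f i (x ord0))).
Proof.
rewrite delta_Alt_tensor scalrfctE Alt_tensorE.
rewrite [LHS]mulrA factS natrM invfM mulrA mulfV ?pnatr_eq0// mul1r.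
congr (_ * _).
pose A : 'M[R]_(1 + p) := \matrix_(i, j) gcons (cst 1) f i (x j).
rewrite -[LHS]/(\det A).
pose T : 'M[R]_(1 + p) := block_mx 1%:M (const_mx (-1)) 0 1%:M.
have -> : \det A = \det (A *m T).
  by rewrite det_mulmx det_ublock !det1 !mulr1.
have lsh (i : 'I_1) : (lshift p i : 'I_p.+1) = ord0.
  by apply/val_inj; rewrite /= ord1.
have rsh (i : 'I_p) : (rshift 1 i : 'I_p.+1) = lift ord0 i by apply/val_inj.
rewrite -[A]submxK mulmx_block !mulmx1 !mulmx0 !addr0.
have -> : ursubmx A = const_mx 1.
  by apply/matrixP => i j; rewrite !mxE lsh gcons0.
have -> : ulsubmx A = 1%:M.
  by apply/matrixP => i j; rewrite !mxE lsh gcons0 !ord1.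
rewrite mul1mx (_ : const_mx (-1) + _ = 0); last first.
  by apply/matrixP => i j; rewrite !mxE addNr.
rewrite det_lblock det1 mul1r; congr (\det _).
apply/matrixP => i j; rewrite !mxE big_ord1 !mxE lsh !rsh.
by rewrite !gconsS mulrN1 addrC.
Qed.

End alternated_tensors.

Section topology.
Variables (R : realType) (X : pmetricType R).

Lemma ptws_open_diagonal n (A : set ('I_n -> X)) (z : X) :
  open (A : set {ptws 'I_n -> X}) -> A (fun=> z) ->
  exists2 U : set X, open_nbhs z U & forall x, (forall i, U (x i)) -> A x.
Proof.
move=> oA Az.
pose G := filter_from (nbhs z) (fun U => [set x : 'I_n -> X | forall i, U (x i)]).
have FG : Filter G.
  apply: filter_from_filter; first by exists setT; exact: filterT.
  move=> U V Uz Vz; exists (U `&` V); first exact: filterI.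
  by move=> x UV; split=> i; have [] := UV i.
have Gz : {ptws, G --> (fun=> z)}.
  apply/cvg_sup => i; rewrite cvg_image; last first.
    by rewrite eqEsubset; split=> v // _; exists (cst v).
  move=> W Wz; exists (@^~ i @^-1` W); last first.
    by rewrite eqEsubset; split=> [v [x + <-]//|v Wv]; exists (cst v).
  by exists W => // x; exact.
have [U Uz UA] : G A by apply: Gz; apply: open_nbhs_nbhs.
exists (interior U).
  by split; [exact: open_interior|exact: nbhs_singleton (nbhs_interior Uz)].
by move=> x Ux; apply: UA => i; exact: interior_subset.
Qed.

Lemma ae_local (mu : {measure set (borel X) -> \bar R}) (P : set X) :
  separable X ->
  (forall z : X, exists2 U : set X,
    nbhs z U & {ae mu, forall x, U x -> P x}) ->
  {ae mu, forall x, P x}.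
Proof.
move=> [S /countable_injP[e einj] dS] loc.
pose B (s : X) k : set X := ball s (k.+1%:R^-1 : R).
pose good s k := {ae mu, forall x, B s k x -> P x}.
pose F k n : set (borel X) :=
  [set x | exists s, [/\ S s, e s = n, good s k, B s k x & ~ P x]].
have nF k n : mu.-negligible (F k n).
  have [[s [Ss es gs]]|nos] := pselect (exists s, [/\ S s, e s = n & good s k]).
    apply: (negligibleS _ gs) => x [t [St et _ Bx nPx]] /= /(_ _)/nPx; apply.
    by have -> : s = t; [apply: einj; rewrite ?inE// es|].
  apply: (negligibleS _ (negligible_set0 _)) => x [t [St et gt _ _]].
  by apply: nos; exists t.
apply: (negligibleS (A := \bigcup_k \bigcup_n F k n)); last first.
  by apply: negligible_bigcup => k; apply: negligible_bigcup => n.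
move=> z /= nPz.
have [U /nbhs_ballP[r /= r0 rU] aeU] := loc z.
have r2 : 0 < r / 2 by rewrite divr_gt0.
have [k kr] : exists k, k.+1%:R^-1 < r / 2 :> R.
  have [k _ kr] := near_infty_natSinv_lt (PosNum r2).
  by exists k; exact: (kr k (leqnn k)).
have k0 : 0 < k.+1%:R^-1 :> R by rewrite invr_gt0.
have [s [/interior_subset zs Ss]] :
    interior (ball z (k.+1%:R^-1)) `&` S !=set0.
  apply: dS; last exact: open_interior.
  by exists z; apply: nbhs_singleton; apply: nbhs_interior; exact: nbhsx_ballx.
exists k => //; exists (e s) => //; exists s; split=> //; last exact: ball_sym.
apply: (negligibleS _ aeU) => x /= nP UP; apply: nP => sx; apply: UP.
apply: rU.
apply: le_ball (ball_triangle zs sx).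
by rewrite [leRHS]splitr lerD// ltW.
Qed.

Lemma bump (z : X) (r : R) : 0 < r ->
  exists f : X -> R, [/\ continuous f, f z = 1, (forall x, 0 <= f x <= 1) &
    forall x, f x != 0 -> ball z r x].
Proof.
move=> r0; exists (fun x => Num.max 0 (1 - mdist z x / r)); split.
- have cd : continuous (fun x => mdist z x).
    move=> x; apply/cvgrPdist_lt => e e0; near=> y.
    have : ball x e y by near: y; exact: nbhsx_ballx.
    rewrite ballEmdist/= => xy; rewrite ltr_norml; apply/andP; split.
      by have := metric_triangle z x y; lra.
    by have := metric_triangle z y x; rewrite (metric_sym y x); lra.
  apply: (@max_fun_continuous _ X R (fun=> 0)); first exact: cst_continuous.
  move=> x; apply: cvgB; first exact: cvg_cst.
  by apply: cvgM; [exact: cd|exact: cvg_cst].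
- by rewrite mdistxx mul0r subr0; apply/max_idPr.
- move=> x; rewrite le_max lexx/= ge_max ler01/= gerBl.
  by rewrite divr_ge0 ?mdist_ge0// ltW.
- move=> x; rewrite ballEmdist/= => fx; rewrite ltNge; apply/negP => rx.
  move/eqP: fx; apply; apply/max_idPl; rewrite subr_le0 ler_pdivlMr//.
  by rewrite mul1r.
Unshelve. all: by end_near. Qed.

End topology.

Section cutoff.
Variables (R : realType) (X : pmetricType R).
Variable mu : {measure set (borel X) -> \bar R}.
Variables (D : set (X -> R)) (E : (X -> R) -> (X -> R) -> R).
Hypothesis X_locally_compact : locally_compact [set: X].
Hypothesis E_dirichlet : dirichlet_form mu D E.
Hypothesis E_regular : regular mu D E.

Let clip (f : X -> R) x := Num.min (Num.max (f x) 0) 1.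

Let domZ a f : D f -> D (a *: f).
Proof.
move=> Df; rewrite -[_ *: _]addr0.
by apply: (df_domP E_dirichlet) => //; exact: (df_dom0 E_dirichlet).
Qed.

Let dom_clip f : D f -> D (clip f).
Proof. by move=> /(df_markov E_dirichlet)[]. Qed.

(* [2 clip(g/2) - clip(4g)/4] is [max(g - 1/4, 0)] where [g <= 2]. *)
Lemma cutoff (z : X) (U : set X) : nbhs z U ->
  exists (chi : X -> R) (V : set X), [/\ bdom D chi, nbhs z V,
    forall x, V x -> chi x != 0 & forall x, ~ U x -> chi x = 0].
Proof.
move=> Uz; have [K] := X_locally_compact (x := z) I.
rewrite withinET => Kz [cK clK].
have UKz : nbhs z (U `&` K) by exact: filterI.
move: UKz => /nbhs_ballP[r /= r0 rUK].
have [f [cf fz f01 fr]] := bump z r0.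
have Cf : @Cc R X f.
  split=> //; apply: (@subclosed_compact _ _ K) => //.
    exact: closed_closure.
  rewrite [X in _ `<=` X](closure_id K).1//; apply: closureS => x /= /fr.
  by move=> /rUK[].
have q0 : 0 < 4^-1 :> R by rewrite invr_gt0.
have [g [[cg _] Dg] fg] := regular_sup E_regular Cf q0.
pose chi := 2 *: clip (2^-1 *: g) - 4^-1 *: clip (4 *: g).
have chiE x : chi x = Num.max (g x - 4^-1) 0.
  have gx2 : g x <= 2.
    have := fg x; have /andP[_] := f01 x; rewrite ler_norml => ? /andP[]; lra.
  rewrite /chi /clip !fctE /= /GRing.scale/= /Num.min /Num.max.
  case: (ltP (2^-1 * g x)) => ?; case: (ltP (4 * g x)) => ?;
    by do ![case: ltP => ?]; lra.
exists chi, [set x | 4^-1 < g x]; split.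
- split.
    rewrite /chi addrC -scaleNr; apply: (df_domP E_dirichlet).
      by apply: dom_clip; exact: domZ.
    by apply: domZ; apply: dom_clip; exact: domZ.
  exists 2 => x; rewrite chiE.
  have := fg x; have /andP[] := f01 x; rewrite !ler_norml => ? ? /andP[? ?].
  by rewrite /Num.max; case: ltP => ?; apply/andP; split; lra.
- have gz : 4^-1 < g z.
    by have := fg z; rewrite fz ler_norml => /andP[? ?]; lra.
  exact: (cvgr_gt _ (cg z)).
- by move=> x /= gx; rewrite chiE gt_eqF// lt_max subr_gt0 gx.
- move=> x nUx; rewrite chiE; have := fg x.
  have [->|/fr/rUK[]//] := eqVneq (f x) 0.
  rewrite sub0r normrN ler_norml => /andP[_ gx]; apply/max_idPr; lra.
Qed.

End cutoff.

(* The library's instance is not found through the alias [borel X] of [X]. *)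
Lemma ae_filter_borel (R : realType) (X : pmetricType R)
  (mu : {measure set (borel X) -> \bar R}) : Filter (almost_everywhere mu).
Proof. exact: ae_filter_ringOfSetsType. Qed.

#[local] Hint Extern 0 (Filter _) => (apply: ae_filter_borel) : typeclass_instances.

Section differentials.
Variables (R : realType) (X : pmetricType R).
Variable mu : {measure set (borel X) -> \bar R}.
Variables (D : set (X -> R)) (E : (X -> R) -> (X -> R) -> R).
Variables (Gam : (X -> R) -> (X -> R) -> X -> R) (C : subalgebra R X).
Variable FO : first_order_structure mu D E Gam C.
Hypothesis C_sub : C `<=` D `&` @Cb R X.

Let C0 : linsub_set C 0. Proof. by case: (linsub_subproof C). Qed.

Let CP a u v : linsub_set C u -> linsub_set C v -> linsub_set C (a *: u + v).
Proof. by case: (linsub_subproof C) => _; exact. Qed.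

Let bdomC f : linsub_set C f -> bdom D f.
Proof. by move=> /C_sub[Df [_ bf]]. Qed.

Let d00 : {ae mu, forall x, d0 FO 0 x = 0}.
Proof.
have := fo_d0P FO 1 (bdomC C0) (bdomC C0).
apply: filterS => x; rewrite !scale1r addr0 => /esym/eqP.
by rewrite -subr_eq0 addrK => /eqP.
Qed.

(* [s] is [d_0 u] for [u] in the algebra spanned by [C] and the constants. *)
Definition is_differential (u : X -> R) (s : forall x, cot FO x) : Prop :=
  exists h c, [/\ linsub_set C h, u = h + cst c &
    {ae mu, forall x, s x = d0 FO h x}].

Lemma is_differential_d0 h c : linsub_set C h ->
  is_differential (h + cst c) (d0 FO h).
Proof. by move=> Ch; exists h, c; split=> //; exact: aeW. Qed.

Lemma is_differential1 : is_differential (cst 1) (fun=> 0).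
Proof.
exists 0, 1; split=> //; first by rewrite add0r.
by apply: filterS d00 => x ->.
Qed.

Lemma is_differentialP a u v s t : is_differential u s ->
  is_differential v t -> is_differential (a *: u + v) (fun x => a *: s x + t x).
Proof.
move=> [h [c [Ch -> sh]]] [k [e [Ck -> tk]]].
exists (a *: h + k), (a * c + e); split; first exact: CP.
  by apply/funext => x; rewrite !fctE /GRing.scale/=; ring.
have := fo_d0P FO a (bdomC Ch) (bdomC Ck).
by apply: filterS3 sh tk => x -> -> ->.
Qed.

Lemma is_differentialM u v s t : is_differential u s ->
  is_differential v t ->
  is_differential (u * v) (fun x => u x *: t x + v x *: s x).
Proof.
move=> [h [c [Ch -> sh]]] [k [e [Ck -> tk]]].
have Chk : linsub_set C (h * k) by exact: subalgebraM.
have Che : linsub_set C (e *: h + h * k) by exact: CP.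
exists (c *: k + (e *: h + h * k)), (c * e); split; first exact: CP.
  by apply/funext => x; rewrite !fctE /GRing.scale/=; ring.
have Dkh := fo_d0P FO c (bdomC Ck) (bdomC Che).
have Dh := fo_d0P FO e (bdomC Ch) (bdomC Chk).
have Lhk := fo_d0_leibniz FO (bdomC Ch) (bdomC Ck).
have H : {ae mu, forall x, d0 FO (c *: k + (e *: h + h * k)) x =
    c *: d0 FO k x + (e *: d0 FO h x + (h x *: d0 FO k x + k x *: d0 FO h x))}.
  by apply: filterS3 Dkh Dh Lhk => x -> -> ->.
apply: filterS3 sh tk H => x -> -> ->.
rewrite !fctE /= !scalerDl (addrC (h x *: _)) -!addrA; congr (_ + _).
by rewrite addrA addrC.
Qed.

Lemma is_differential_sum (J : finType) (b : J -> R) (h : J -> X -> R)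
    (s : J -> forall x, cot FO x) : (forall i, is_differential (h i) (s i)) ->
  is_differential (\sum_i b i *: h i) (fun x => \sum_i b i *: s i x).
Proof.
move=> hs; elim: (index_enum J) => [|i r IH].
  rewrite big_nil (_ : (fun x => _) = fun=> 0); last first.
    by apply: functional_extensionality_dep => x; rewrite big_nil.
  exists 0, 0; split=> //; first by rewrite addr0.
  by apply: filterS d00 => x ->.
rewrite big_cons (_ : (fun x => _) =
  fun x => b i *: s i x + \sum_(i <- r) b i *: s i x); last first.
  by apply: functional_extensionality_dep => x; rewrite big_cons.
exact: is_differentialP.
Qed.

Lemma is_differential_local u s chi (U : set X) : is_differential u s ->
  bdom D chi -> (forall x, ~ U x -> chi x = 0) -> (forall x, U x -> u x = 0) ->
  {ae mu, forall x, chi x != 0 -> s x = 0}.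
Proof.
move=> [h [c [Ch -> sh]]] Dchi chiU uU.
have Ehc : h * chi = (- c) *: chi + 0.
  apply/funext => x; rewrite !fctE /GRing.scale/= addr0.
  have [/uU|/chiU->] := pselect (U x); last by rewrite !mulr0.
  by rewrite !fctE => /eqP; rewrite addr_eq0 => /eqP ->.
have L := fo_d0_leibniz FO (bdomC Ch) Dchi.
have := fo_d0P FO (- c) Dchi (bdomC C0); rewrite -Ehc => P.
have H : {ae mu, forall x,
    (- c) *: d0 FO chi x = h x *: d0 FO chi x + chi x *: d0 FO h x}.
  by apply: filterS3 L P d00 => x -> -> ->; rewrite addr0.
apply: filterS2 sh H => x -> + chi0.
have [/uU|/chiU/eqP] := pselect (U x); last by rewrite (negbTE chi0).
rewrite !fctE => /eqP; rewrite addr_eq0 => /eqP ->.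
move=> /esym/eqP; rewrite -subr_eq0 addrAC subrr add0r scaler_eq0.
by rewrite (negbTE chi0) => /eqP.
Qed.

End differentials.

Section wedge_products.
Variables (R : realType) (H L : hilbert R) (p : nat) (w : ('I_p -> H) -> L).
Hypothesis wP : exterior_power w.

Lemma wedge_perm (v : 'I_p -> H) (s : 'S_p) : w (v \o s) = (-1) ^+ s *: w v.
Proof.
pose a := (- (-1) ^+ s) *: w v + w (v \o s).
have aw u : dotp a (w u) = 0.
  rewrite dotpP !(ext_dot wP).
  rewrite (_ : \matrix_(i, k) dotp ((v \o s) i) (u k) =
    row_perm s (\matrix_(i, k) dotp (v i) (u k))); last first.
    by apply/matrixP => i k; rewrite !mxE.
  by rewrite row_permE det_mulmx det_perm mulNr addNr.
have : dotp a a = 0 by rewrite {2}/a dotpC dotpP !(dotpC _ a) !aw mulr0 addr0.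
rewrite dotp_norm => /eqP; rewrite expf_eq0/= normr_eq0 => /eqP/eqP.
by rewrite /a scaleNr addrC subr_eq0 => /eqP.
Qed.

End wedge_products.

Section well_definedness.
Variables (R : realType) (X : pmetricType R).
Variable mu : {measure set (borel X) -> \bar R}.
Variables (D : set (X -> R)) (E : (X -> R) -> (X -> R) -> R).
Variables (Gam : (X -> R) -> (X -> R) -> X -> R) (C : subalgebra R X).
Variables (N : diagonal_nbhds X).
Variables (FO : first_order_structure mu D E Gam C).
Variable Lam : exterior_bundle (cot FO).
Hypothesis X_locally_compact : locally_compact [set: X].
Hypothesis X_separable : separable X.
Hypothesis E_dirichlet : dirichlet_form mu D E.
Hypothesis E_regular : regular mu D E.
Hypothesis C_sub : C `<=` D `&` @Cb R X.

Lemma differentials_interpolation (z : X) (U : set X) (J : finType)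
    (h : J -> X -> R) (s : J -> forall x, cot FO x) :
  nbhs z U -> (forall i, is_differential (h i) (s i)) ->
  exists (V : set X) n (y : 'I_n -> X) (e : 'I_n -> forall x, cot FO x),
    [/\ nbhs z V, V `<=` U, forall l, U (y l) &
     {ae mu, forall x, V x -> forall i, s i x = \sum_l h i (y l) *: e l x}].
Proof.
move=> Uz hs.
have [chi [V [Dchi Vz Vchi chiU]]] :=
  cutoff X_locally_compact E_dirichlet E_regular Uz.
have [n [y [b [Uy yb]]]] := interpolation U h.
exists (V `&` U), n, y, (fun l x => \sum_i b l i *: s i x); split=> //.
- exact: filterI.
pose u j := (-1) *: h j + \sum_l h j (y l) *: \sum_i b l i *: h i.
have ds j : is_differential (u j)
    (fun x => (-1) *: s j x + \sum_l h j (y l) *: \sum_i b l i *: s i x).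
  apply: is_differentialP => //.
  apply: (is_differential_sum C_sub) => l.
  exact: (is_differential_sum C_sub).
have uU j x : U x -> u j x = 0.
  move=> Ux; rewrite /u !fctE fct_sumE scaleN1r.
  rewrite [X in _ + X](_ : _ = h j x) ?addNr//.
  rewrite (yb x j Ux); apply: eq_bigr => l _.
  rewrite !fctE; congr (_ * _); rewrite fct_sumE.
  by apply: eq_bigr => i _.
have H : {ae mu, forall x, forall j, chi x != 0 ->
    (-1) *: s j x + \sum_l h j (y l) *: \sum_i b l i *: s i x = 0}.
  apply: filter_forall => j.
  exact: (is_differential_local C_sub (ds j) Dchi chiU (uU j)).
apply: filterS H => x H [/Vchi chix _] j.
by have /eqP := H j chix; rewrite scaleN1r addrC subr_eq0 => /eqP.
Qed.

Lemma wedge_sum_eq0 p (J : finType) (g : J -> X -> R) (f : J -> 'I_p -> X -> R) :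
  (forall i, with_constants C (g i)) -> (forall i k, linsub_set C (f i k)) ->
  (forall x, N p x ->
    (\sum_i average (g i) * delta (Alt (tensor (f i)))) x = 0) ->
  {ae mu, forall x,
    \sum_i g i x *: wedge Lam (fun k => d0 FO (f i k) x) = 0}.
Proof.
move=> Cg Cf F0; apply: ae_local => // z.
have [U Uz UN] := ptws_open_diagonal (@diag_open _ _ N p) (diag_mem N p z).
have /choice[gs gsP] i : exists s, is_differential (FO := FO) (g i) s.
  by have [h [c [Ch ->]]] := Cg i; exists (d0 FO h); exact: is_differential_d0.
have fs i k : is_differential (FO := FO) (f i k) (d0 FO (f i k)).
  by have := is_differential_d0 FO 0 (Cf i k); rewrite addr0.
pose u i (a : bool) : X -> R := if a then g i else cst 1.
pose us i (a : bool) : forall x, cot FO x := if a then gs i else fun=> 0.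
pose v i (k : option 'I_p) : X -> R := if k is Some k then f i k else cst 1.
pose vs i (k : option 'I_p) : forall x, cot FO x :=
  if k is Some k then d0 FO (f i k) else fun=> 0.
pose h (t : J * bool * option 'I_p) := u t.1.1 t.1.2 * v t.1.1 t.2.
pose s (t : J * bool * option 'I_p) : forall x, cot FO x := fun x =>
  u t.1.1 t.1.2 x *: vs t.1.1 t.2 x + v t.1.1 t.2 x *: us t.1.1 t.1.2 x.
have hs t : is_differential (h t) (s t).
  case: t => [[i a] k]; apply: (is_differentialM C_sub).
    by case: a; [exact: gsP|exact: is_differential1].
  by case: k => [k|]; [exact: fs|exact: is_differential1].
have [V [m [y [e [Vz VU Uy sV]]]]] :=
  differentials_interpolation (open_nbhs_nbhs Uz) hs.
exists V => //; apply: filterS sV => x + Vx => /(_ Vx) sx.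
pose w := @wedge _ _ _ Lam p x.
have wE := wedgeP Lam p x.
have wP : multilinear w by exact: ext_multilinear wE.
pose a (t : J * 'S_p * 'I_p.+1) : R :=
  (-1) ^+ t.1.2 * (if t.2 == ord0 then g t.1.1 x else 1).
pose c (t : J * 'S_p * 'I_p.+1) (k : 'I_p) (l : 'I_m) : R :=
  (if t.2 == lift ord0 k then g t.1.1 (y l) else 1) *
  (f t.1.1 (t.1.2 k) (y l) - f t.1.1 (t.1.2 k) x).
have cE t k : \sum_l c t k l *: e l x =
    (if t.2 == lift ord0 k then g t.1.1 x else 1) *:
    d0 FO (f t.1.1 (t.1.2 k)) x.
  case: t => [[i r] j] /=.
  pose b := j == lift ord0 k.
  have -> : \sum_l c (i, r, j) k l *: e l x =
      s (i, b, Some (r k)) x - f i (r k) x *: s (i, b, None) x.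
    rewrite !sx scaler_sumr -sumrB; apply: eq_bigr => l _.
    rewrite scalerA -scalerBl /c /h /= -/b; congr (_ *: _).
    by case: b; rewrite !fctE /=; ring.
  rewrite /s /= /us /vs /u /v /= -/b; case: b => /=.
    by rewrite scaler0 add0r !scale1r -addrA subrr addr0.
  by rewrite !(scaler0, addr0) subr0.
have sumE (V' : nmodType) (G : J * 'S_p * 'I_p.+1 -> V') :
    \sum_t G t = \sum_i \sum_r \sum_j G (i, r, j).
  by rewrite !pair_bigA; apply: eq_bigr => -[[i r] j].
have Q (l : 'I_p -> 'I_m) : \sum_t a t * \prod_k c t k (l k) = 0.
  pose xx := gcons x (y \o l).
  have Nxx : N p xx.
    apply: UN => k; rewrite /xx; case: (unliftP ord0 k) => [k' ->|->].
      by rewrite gconsS; exact: Uy.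
    by rewrite gcons0; exact: VU.
  have := F0 _ Nxx; rewrite fct_sumE => /(congr1 ( *%R (p.+1`!%:R))).
  rewrite mulr0 mulr_sumr => F0x; rewrite -[RHS]F0x sumE; apply: eq_bigr => i _.
  rewrite !fctE /average delta_Alt_base -det_tr /determinant.
  rewrite factS natrM mulrACA -!mulrA mulVKf ?pnatr_eq0//.
  rewrite mulVKf ?pnatr_eq0 -?lt0n ?fact_gt0// mulr_sumr.
  apply: eq_bigr => r _; rewrite mulr_suml; apply: eq_bigr => j _.
  rewrite /a /c /= big_split /= [RHS]mulrCA -!mulrA; congr (_ * _).
  rewrite mulrA; congr (_ * _); last first.
    by apply: eq_bigr => k _; rewrite !mxE /xx gconsS gcons0.
  case: (unliftP ord0 j) => [k ->|->]; rewrite /xx.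
    rewrite gconsS (bigD1 k)//= eqxx big1 ?mulr1 ?mul1r//= => k' k'k.
    by rewrite (inj_eq (@lift_inj _ _)) eq_sym (negbTE k'k).
  by rewrite gcons0 eqxx big1 ?mulr1// => k _; rewrite (negbTE (neq_lift _ _)).
have aE t : a t *: w (fun k => \sum_l c t k l *: e l x) =
    g t.1.1 x *: w (fun k => d0 FO (f t.1.1 k) x).
  rewrite (_ : (fun k => _) = fun k =>
    (if t.2 == lift ord0 k then g t.1.1 x else 1) *:
    d0 FO (f t.1.1 (t.1.2 k)) x); last by apply/funext => k; exact: cE.
  case: t => [[i r] j]; rewrite /a /=.
  have wr : w (fun k => d0 FO (f i (r k)) x) =
      (-1) ^+ r *: w (fun k => d0 FO (f i k) x).
    exact: (wedge_perm wE (fun k => d0 FO (f i k) x)).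
  case: (unliftP ord0 j) => [k ->|->].
    rewrite (_ : (fun k => _) = fun k' =>
      (if k' == k then g i x else 1) *: d0 FO (f i (r k')) x); last first.
      by apply/funext => k'; rewrite (inj_eq (@lift_inj _ _)) eq_sym.
    rewrite multilinear_scale// wr mulr1 !scalerA mulrC mulrA.
    by rewrite -expr2 sqrr_sign mul1r.
  rewrite (_ : (fun k => _) = fun k' => d0 FO (f i (r k')) x); last first.
    by apply/funext => k'; rewrite (negbTE (neq_lift _ _)) scale1r.
  by rewrite wr eqxx scalerA mulrAC -expr2 sqrr_sign mul1r.
have := multilinear_tensor_eq0 (fun l => e l x) wP Q.
under eq_bigr do rewrite aE; rewrite sumE /=.
under eq_bigr do rewrite !sumr_const -mulrnA -scaler_nat.
rewrite -scaler_sumr => /eqP; rewrite scaler_eq0 pnatr_eq0 muln_eq0.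
by case/orP => [/orP[]|/eqP//] => /eqP/card0_eq;
  [move/(_ ord0)|move/(_ 1%g)].
Qed.

End well_definedness.

Section linear_relations.
Variable R : realType.

Lemma linear_of_relation (V W : lmodType R) (P : V -> W -> Prop) :
  (forall v, exists w, P v w) -> (forall w, P 0 w -> w = 0) ->
  (forall a u v w z, P u w -> P v z -> P (a *: u + v) (a *: w + z)) ->
  exists f : {linear V -> W}, (forall v, P v (f v)) /\
    forall v w, P v w -> f v = w.
Proof.
move=> tot P0 lin; have [f fP] := choice tot.
have uniq v w : P v w -> f v = w.
  move=> vw; have := lin (-1) _ _ _ _ (fP v) vw.
  rewrite !scaleN1r addNr => /P0 /eqP.
  by rewrite addrC subr_eq0 => /eqP ->.
have flin : linear f by move=> a u v; apply: uniq; exact: lin.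
pose fL := HB.pack_for {linear V -> W} f
  (GRing.isLinear.Build R V W _ f flin).
by exists fL.
Qed.

Lemma linsub_sum (V : lmodType R) (S : linsub V) (I : finType) (s : I -> V) :
  (forall i, linsub_set S (s i)) -> linsub_set S (\sum_i s i).
Proof.
have [S0 Slin] := linsub_subproof S.
move=> Ss; elim/big_ind: _ => // u v Su Sv.
by rewrite -[u]scale1r; exact: Slin.
Qed.

Lemma linsubZ (V : lmodType R) (S : linsub V) a v :
  linsub_set S v -> linsub_set S (a *: v).
Proof.
have [S0 Slin] := linsub_subproof S.
by move=> Sv; rewrite -[_ *: _]addr0; exact: Slin.
Qed.

Lemma linsubD (V : lmodType R) (S : linsub V) u v :
  linsub_set S u -> linsub_set S v -> linsub_set S (u + v).
Proof.
have [S0 Slin] := linsub_subproof S.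
by rewrite -{2}[u]scale1r; exact: Slin.
Qed.

Lemma lspan_gen (V : lmodType R) (A : set V) v : A v -> linsub_set (lspan A) v.
Proof.
move=> Av; exists 1%N, (fun=> 1), (fun=> v); split=> //.
by rewrite big_ord1 scale1r.
Qed.

Lemma lspan_sub (V : lmodType R) (A : set V) (S : linsub V) :
  A `<=` S -> lspan A `<=` S.
Proof.
move=> AS _ [n [a [s [As ->]]]]; apply: linsub_sum => i.
by apply: linsubZ; exact: AS.
Qed.

Lemma cohomology_map (V W : nat -> lmodType R)
    (d : forall p, {linear V p -> V p.+1})
    (e : forall p, {linear W p -> W p.+1})
    (lam : forall p, {linear V p -> W p}) :
  (forall p v, e p (lam p v) = lam p.+1 (d p v)) ->
  forall p, exists lamH : {linear cohomology d p -> cohomology e p},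
    forall z : cocycle d p, exists2 w : cocycle e p,
      \val w = lam p (\val z) & lamH (cohomology_class z) = cohomology_class w.
Proof.
move=> elam p.
have lamZ (z : cocycle d p) :
    linsub_set (lpreimage (e p) (lzero _)) (lam p (\val z)).
  by rewrite /= /preimage /= elam (subspace_valP z) linear0.
have lamB (z : cocycle d p) (w : cocycle e p) : \val w = lam p (\val z) ->
    linsub_set (coboundaries d p) (\val z) ->
    linsub_set (coboundaries e p) (\val w).
  move=> ->; case: p {lamZ} z w => [|p] z w /=; first by move=> ->; rewrite linear0.
  by move=> [u _ <-]; exists (lam p u) => //; rewrite elam.
pose P (x : cohomology d p) (y : cohomology e p) := exists z w,
  [/\ \val w = lam p (\val z), x = cohomology_class z & y = cohomology_class w].
have [||| f [_ fu]] := @linear_of_relation _ _ P.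
- move=> x; pose z : cocycle d p := repr x.
  exists (cohomology_class (subspace_Sub (lamZ z))), z, (subspace_Sub (lamZ z)).
  by split=> //; rewrite /cohomology_class qclass_repr.
- move=> y [z [w [wz z0 ->]]].
  have zB : linsub_set (coboundaries d p) (\val z).
    have : cohomology_class z = cohomology_class 0.
      by rewrite -z0 /cohomology_class linear0.
    by move/qclass_eqP; rewrite subr0.
  rewrite -[RHS](linear0 (qclass (lpreimage
    (\val : {linear cocycle e p -> W p}) (coboundaries e p)))).
  by apply/qclass_eqP; rewrite subr0; exact: lamB zB.
- move=> a x1 x2 y1 y2 [z1 [w1 [e1 -> ->]]] [z2 [w2 [e2 -> ->]]].
  exists (a *: z1 + z2), (a *: w1 + w2); split.
  + transitivity (a *: \val w1 + \val w2); first exact: linearP.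
    by rewrite e1 e2 -linearP; congr (lam p _); apply/esym; exact: linearP.
  + by rewrite /cohomology_class linearP.
  + by rewrite /cohomology_class linearP.
exists f => z; exists (subspace_Sub (lamZ z)) => //.
by apply: fu; exists z, (subspace_Sub (lamZ z)).
Qed.

End linear_relations.

Section average_spans.
Variables (R : realType) (X : pmetricType R) (C : subalgebra R X).
Local Notation fn n := (('I_n -> X) -> R).

Lemma with_constants_sub : C `<=` with_constants C.
Proof. by move=> h Ch; exists h, 0; rewrite addr0. Qed.

Lemma with_constants1 : with_constants C (cst 1).
Proof.
by exists 0, 1; rewrite add0r; split=> //; case: (linsub_subproof C).
Qed.

Lemma with_constantsZ a g : with_constants C g -> with_constants C (a *: g).
Proof.
move=> [h [c [Ch ->]]]; exists (a *: h), (a * c); split; first exact: linsubZ.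
by apply/funext => x; rewrite !fctE /GRing.scale/= mulrDr.
Qed.

Lemma with_constantsM g f : with_constants C g -> linsub_set C f ->
  linsub_set C (g * f).
Proof.
move=> [h [c [Ch ->]]] Cf; rewrite (_ : _ * f = h * f + c *: f).
  by apply: linsubD; [exact: subalgebraM|exact: linsubZ].
by apply/funext => x; rewrite !fctE /GRing.scale/= mulrDl.
Qed.

Lemma averageZ n a (g : X -> R) (F : fn n.+1) :
  average (a *: g) * F = a *: (average g * F).
Proof.
apply/funext => x; rewrite !fctE /average /GRing.scale/= mulrA; congr (_ * _).
by rewrite mulrCA; congr (_ * _); rewrite mulr_sumr.
Qed.

Lemma average1 n : average (n := n) (cst 1 : X -> R) = 1.
Proof.
apply/funext => x; rewrite /average /= sumr_const card_ord.
by rewrite mulVf// pnatr_eq0.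
Qed.

Definition average_generators p : set (fn p.+1) :=
  [set F | exists g (f : 'I_p -> X -> R), [/\ with_constants C g,
    forall k, linsub_set C (f k) & F = average g * delta (Alt (tensor f))]].
Arguments average_generators p _ : clear implicits.

Lemma Alt_tensor1 p (f : 'I_p -> X -> R) : Alt (tensor (gcons (cst 1) f)) =
  average ((p.+1%:R)^-1 *: cst 1) * delta (Alt (tensor f)).
Proof.
rewrite averageZ average1 delta_Alt_tensor mul1r scalerA mulVf.
  by rewrite scale1r.
by rewrite pnatr_eq0.
Qed.

Lemma global_cochains_average p :
  linsub_set (global_cochains C p.+1) = lspan (average_generators p.+1).
Proof.
have C1 (f : 'I_p.+1 -> X -> R) k g : with_constants C g ->
    (forall i, linsub_set C (f i)) ->
    forall i, linsub_set C (if i == k then g * f i else f i).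
  by move=> Cg Cf i; case: ifP => // _; exact: with_constantsM.
apply/seteqP; split; apply: lspan_sub => F.
- move=> [f [f0 fC ->]]; rewrite [f]gcons_eta; set g := f ord0.
  set f' := fun i => f (lift ord0 i).
  have /eqP := average_delta_Alt g f'; rewrite -subr_eq => /eqP <-.
  apply: linsubD; first by apply: lspan_gen; exists g, f'.
  rewrite -scaleN1r; apply: linsubZ; apply: linsub_sum => k.
  rewrite Alt_tensor1; apply: lspan_gen; eexists _, _; split=> //.
    by apply: with_constantsZ; exact: with_constants1.
  exact: C1.
- move=> [g [f [Cg Cf ->]]]; rewrite average_delta_Alt; apply: linsubD.
    apply: lspan_gen; exists (gcons g f); split=> // [|i]; first by rewrite gcons0.
    by rewrite gconsS.
  apply: linsub_sum => k; apply: lspan_gen; eexists; split; last reflexivity.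
    by rewrite gcons0; exact: with_constants1.
  by move=> i; rewrite gconsS; exact: C1.
Qed.

Lemma global_cochains_averageP p F : linsub_set (global_cochains C p.+1) F <->
  exists (n : nat) (g : 'I_n -> X -> R) (f : 'I_n -> 'I_p.+1 -> X -> R),
    [/\ forall i, with_constants C (g i), forall i k, linsub_set C (f i k) &
      F = \sum_i average (g i) * delta (Alt (tensor (f i)))].
Proof.
rewrite global_cochains_average; split=> [[n [a [s [sG ->]]]]|].
  have /choice[g] := sG; move=> /choice[f gf].
  exists n, (fun i => a i *: g i), f; split=> [i|i|].
  - by apply: with_constantsZ; have [] := gf i.
  - by have [] := gf i.
  - by apply: eq_bigr => i _; rewrite averageZ; have [_ _ <-] := gf i.
move=> [n [g [f [Cg Cf ->]]]]; apply: linsub_sum => i; apply: lspan_gen.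
by exists (g i), (f i).
Qed.

Lemma delta_average p g (h : X -> R) c (f : 'I_p -> X -> R) : g = h + cst c ->
  delta (average g * delta (Alt (tensor f))) =
  average (cst 1) * delta (Alt (tensor (gcons h f))).
Proof.
move=> ->; rewrite average_delta_Alt linearD linear_sum /= big1 => [|k _].
  by rewrite addr0 average1 mul1r !delta_Alt_tensor Alt_tensor_shift.
rewrite delta_Alt_tensor (_ : Alt _ = 0) ?scaler0//.
apply/funext => x; rewrite Alt_tensorE.
rewrite (determinant_alternate (i1 := ord0) (i2 := lift ord0 ord0)) ?mulr0//.
by move=> j; rewrite !mxE gconsS !gcons0.
Qed.

End average_spans.

Section forms_and_lambda.
Variables (R : realType) (X : pmetricType R).
Variable mu : {measure set (borel X) -> \bar R}.
Variables (D : set (X -> R)) (E : (X -> R) -> (X -> R) -> R).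
Variables (Gam : (X -> R) -> (X -> R) -> X -> R) (C : subalgebra R X).
Variables (N : diagonal_nbhds X).
Variables (FO : first_order_structure mu D E Gam C).
Variable Lam : exterior_bundle (cot FO).

Lemma simple_formZ p a g (f : 'I_p -> X -> R) :
  simple_form Lam (a *: g) f = a *: simple_form Lam g f.
Proof.
case: p f => [//|p] f; rewrite /simple_form /section_class -linearZ.
congr (qclass _ _); apply: functional_extensionality_dep => x.
by rewrite sections_scaleE scalerA.
Qed.

Lemma forms_subP p w : linsub_set (forms_sub Lam p) w <->
  exists (n : nat) (g : 'I_n -> X -> R) (f : 'I_n -> 'I_p -> X -> R),
    [/\ forall i, with_constants C (g i), forall i k, linsub_set C (f i k) &
      w = \sum_i simple_form Lam (g i) (f i)].
Proof.
split=> [[n [a [s [sG ->]]]]|[n [g [f [Cg Cf ->]]]]].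
  have /choice[g] := sG; move=> /choice[f gf].
  exists n, (fun i => a i *: g i), f; split=> [i|i|].
  - by apply: with_constantsZ; have [] := gf i.
  - by have [] := gf i.
  - by apply: eq_bigr => i _; rewrite simple_formZ; have [_ _ <-] := gf i.
apply: (@linsub_sum _ _ (forms_sub Lam p)) => i; apply: lspan_gen.
by exists (g i), (f i).
Qed.

Hypothesis X_locally_compact : locally_compact [set: X].
Hypothesis X_separable : separable X.
Hypothesis E_dirichlet : dirichlet_form mu D E.
Hypothesis E_regular : regular mu D E.
Hypothesis C_sub : C `<=` D `&` @Cb R X.

Lemma sum_sectionsE (H : X -> lmodType R) (J : finType) (s : J -> sections H) x :
  (\sum_i s i) x = \sum_i s i x.
Proof. by elim/big_rec2: _ => // i y z _ <-. Qed.

Lemma simple_form_sum_eq0 p (J : finType) (g : J -> X -> R)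
    (f : J -> 'I_p.+1 -> X -> R) :
  (forall i, with_constants C (g i)) -> (forall i k, linsub_set C (f i k)) ->
  restrictN (N p.+1) (\sum_i average (g i) * delta (Alt (tensor (f i)))) = 0 ->
  \sum_i simple_form Lam (g i) (f i) = 0.
Proof.
move=> Cg Cf F0; rewrite /simple_form /section_class -linear_sum.
rewrite -[RHS](linear0 (qclass _)); apply/qclass_eqP; rewrite subr0.
have H := wedge_sum_eq0 (N := N) Lam X_locally_compact X_separable
  E_dirichlet E_regular C_sub Cg Cf.
have {}H := H _; apply: filterS (H _) => [x Hx|x Nx].
  by rewrite sum_sectionsE.
by have /(congr1 (fun F => F x)) := F0; rewrite /restrictN patchE mem_set.
Qed.

Lemma Alt_tensor_ord1 (f : 'I_1 -> X -> R) :
  Alt (tensor f) = fun x => f ord0 (x ord0).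
Proof.
by apply/funext => x; rewrite Alt_tensorE det_mx11 mxE invr1 mul1r.
Qed.

(* The graph of [lam_p]. *)
Definition lambda_graph p : cochains C N p -> forms Lam p -> Prop :=
  match p with
  | 0 => fun F w => exists2 f, linsub_set C f &
      \val F = restrictN (N 0%N) (fun x => f (x ord0)) /\ \val w = f
  | q.+1 => fun F w => exists (n : nat) (g : 'I_n -> X -> R)
      (f : 'I_n -> 'I_q.+1 -> X -> R),
      [/\ forall i, with_constants C (g i), forall i k, linsub_set C (f i k),
        \val F = restrictN (N q.+1)
          (\sum_i average (g i) * delta (Alt (tensor (f i)))) &
        \val w = \sum_i simple_form Lam (g i) (f i)]
  end.

Lemma lambda_graph_total p (F : cochains C N p) : exists w, lambda_graph F w.
Proof.
have [G CG FG] := subspace_valP F; case: p F G CG FG => [|p] F G CG FG.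
  have [f Cf Gf] : exists2 f, linsub_set C f & G = fun x => f (x ord0).
    case: CG => n [a [s [sG ->]]]; have /choice[f fP] := sG.
    exists (\sum_i a i *: f i ord0).
      by apply: linsub_sum => i; apply: linsubZ; have [] := fP i.
    apply/funext => x; rewrite !fct_sumE; apply: eq_bigr => i _.
    by have [_ _ ->] := fP i; rewrite Alt_tensor_ord1.
  have w0 : linsub_set (forms_sub Lam 0) f.
    apply: lspan_gen; exists f, (fun=> f); split=> //.
    exact: with_constants_sub.
  by exists (subspace_Sub w0), f => //; split=> //; rewrite -FG Gf.
have [n [g [f [Cg Cf Ge]]]] := (global_cochains_averageP C G).1 CG.
have wf : linsub_set (forms_sub Lam p.+1) (\sum_i simple_form Lam (g i) (f i)).
  by apply/forms_subP; exists n, g, f.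
by exists (subspace_Sub wf), n, g, f; split=> //; rewrite -FG Ge.
Qed.

Lemma lambda_graph0 p w : lambda_graph (0 : cochains C N p) w -> w = 0.
Proof.
case: p w => [|p] w.
  move=> [f Cf [F0 wf]]; apply/val_inj; rewrite wf; apply/funext => x.
  have /(congr1 (fun F => F (fun=> x))) := F0.
  by rewrite /restrictN patchE mem_set//; exact: diag_mem.
move=> [n [g [f [Cg Cf F0 wf]]]]; apply/val_inj; rewrite wf.
by apply: simple_form_sum_eq0 => //; rewrite -F0.
Qed.

Lemma lambda_graph_linear p a (F G : cochains C N p) w z :
  lambda_graph F w -> lambda_graph G z ->
  lambda_graph (a *: F + G) (a *: w + z).
Proof.
case: p F G w z => [|p] F G w z.
  move=> [f Cf [Ff wf]] [k Ck [Gk zk]]; exists (a *: f + k).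
    by case: (linsub_subproof C) => _; exact.
  split.
    transitivity (a *: \val F + \val G); first exact: linearP.
    by rewrite Ff Gk -linearP.
  transitivity (a *: \val w + \val z); first exact: linearP.
  by rewrite wf zk.
move=> [n [g [f [Cg Cf Ff wf]]]] [m [k [h [Ck Ch Gh zh]]]].
exists (n + m)%N, (fun i => match fintype.split i with
    inl i => a *: g i | inr i => k i end),
  (fun i => match fintype.split i with inl i => f i | inr i => h i end).
split=> [i|i l||].
- by case: (fintype.split i) => ? //; exact: with_constantsZ.
- by case: (fintype.split i).
- transitivity (a *: \val F + \val G); first exact: linearP.
  rewrite Ff Gh -linearP; congr (restrictN _ _).
  rewrite big_split_ord scaler_sumr; congr (_ + _); apply: eq_bigr => i _ /=.
    by rewrite (unsplitK (inl i : ('I_n + 'I_m)%type)) averageZ.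
  by rewrite (unsplitK (inr i : ('I_n + 'I_m)%type)).
- transitivity (a *: \val w + \val z); first exact: linearP.
  rewrite wf zh big_split_ord scaler_sumr; congr (_ + _); apply: eq_bigr => i _.
    by rewrite -simple_formZ /= (unsplitK (inl i : ('I_n + 'I_m)%type)).
  by rewrite /= (unsplitK (inr i : ('I_n + 'I_m)%type)).
Qed.

Lemma lambda_graph_surjective p (w : forms Lam p) :
  (0 < p)%N \/ linsub_set C (cst 1) -> exists F, lambda_graph (p := p) F w.
Proof.
move=> pC; have /forms_subP[n [g [f [Cg Cf wf]]]] := subspace_valP w.
case: p w pC f wf Cf => [|p] w pC f wf Cf.
  have C1 : linsub_set C (cst 1) by case: pC.
  have Cw : linsub_set C (\val w).
    rewrite wf; apply: linsub_sum => i; have [h [c [Ch ->]]] := Cg i.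
    rewrite (_ : cst c = c *: cst 1); last first.
      by apply/funext => x; rewrite !fctE /GRing.scale/= mulr1.
    by apply: linsubD => //; exact: linsubZ.
  have SF : linsub_set (cochains_sub C N 0)
      (restrictN (N 0%N) (fun x => \val w (x ord0))).
    exists (fun x => \val w (x ord0)) => //; apply: lspan_gen.
    by exists (fun=> \val w); split=> [//|[]//|]; rewrite Alt_tensor_ord1.
  by exists (subspace_Sub SF), (\val w).
have SF : linsub_set (cochains_sub C N p.+1) (restrictN (N p.+1)
    (\sum_i average (g i) * delta (Alt (tensor (f i))))).
  by eexists; last reflexivity; apply/global_cochains_averageP; exists n, g, f.
by exists (subspace_Sub SF), n, g, f.
Qed.

Lemma lambda_graph_delta (d : forall p, {linear forms Lam p -> forms Lam p.+1})
    p (F : cochains C N p) w : exterior_derivative d -> lambda_graph F w ->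
  lambda_graph (cochain_differential C N p F) (d p w).
Proof.
move=> dP; case: p F w => [|p] F w.
  move=> [f Cf [Ff wf]]; have f0 : 'I_0 -> X -> R by case.
  exists 1%N, (fun=> cst 1), (fun=> gcons f f0); split.
  - by move=> _; exact: with_constants1.
  - by move=> _ k; rewrite ord1 gcons0.
  - rewrite big_ord1 average1 mul1r Alt_tensor_ord1 gcons0.
    by rewrite -delta_restrictN -Ff.
  - rewrite big_ord1; apply: (dP 0%N w f 0) => //; first by case.
    by rewrite wf addr0.
move=> [n [g [f [Cg Cf Ff wf]]]].
have /choice[h /choice[c hc]] := Cg.
exists n, (fun=> cst 1), (fun i => gcons (h i) (f i)); split.
- by move=> _; exact: with_constants1.
- move=> i k; case: (unliftP ord0 k) => [l ->|->]; rewrite ?gconsS ?gcons0//.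
  by have [] := hc i.
- transitivity (restrictN (N p.+2) (delta (\val F))) => //.
  rewrite Ff delta_restrictN linear_sum; congr (restrictN _ _); apply: eq_bigr => i _.
  by apply: delta_average; have [_ ->] := hc i.
have Sw i : linsub_set (forms_sub Lam p.+1) (simple_form Lam (g i) (f i)).
  by apply: lspan_gen; exists (g i), (f i).
have -> : w = \sum_i subspace_Sub (Sw i).
  by apply/val_inj; rewrite wf linear_sum.
rewrite !linear_sum; apply: eq_bigr => i _.
have [Ch gE] := hc i; apply: (dP p.+1 _ (h i) (c i)) => //.
by rewrite /= gE.
Qed.

End forms_and_lambda.

Theorem theorem5p1 (R : realType) (X : pmetricType R)
  (mu : {measure set (borel X) -> \bar R})
  (D : set (X -> R)) (E : (X -> R) -> (X -> R) -> R)
  (Gam : (X -> R) -> (X -> R) -> X -> R)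
  (Theta : Type) (le : Theta -> Theta -> Prop)
  (j : Theta -> set X -> X -> \bar R)
  (C : subalgebra R X) (N : diagonal_nbhds X)
  (FO : first_order_structure mu D E Gam C) (Lam : exterior_bundle (cot FO))
  (X_locally_compact : locally_compact [set: X]) (X_separable : separable X)
  (mu_radon : radon mu) (mu_full_support : full_support mu)
  (E_dirichlet : dirichlet_form mu D E) (E_regular : regular mu D E)
  (E_strongly_local : strongly_local D E)
  (E_cdc : carre_du_champ mu D E Gam)
  (Theta_directed : directed le)
  (j_kernel : forall t, generalized_kernel mu (j t))
  (C_sub : C `<=` D `&` @Cb R X)
  (K : kernel_conditions mu D E le j C)
  (B : gradient_bound mu Gam j C) :
  exists lam : forall p, {linear cochains C N p -> forms Lam p},
    [/\ is_lambda lam,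
        (forall lam', is_lambda lam' -> forall p F, lam' p F = lam p F),
        (forall p, (0 < p)%N \/ linsub_set C (cst 1) ->
           forall w, exists F, lam p F = w),
        [set \val (lam 0%N F) | F in setT] = C &
        forall d : forall p, {linear forms Lam p -> forms Lam p.+1},
          exterior_derivative d ->
          (forall p F, d p (lam p F) = lam p.+1 (cochain_differential C N p F)) /\
          (forall p, exists lamH :
               {linear cohomology (cochain_differential C N) p ->
                       cohomology d p},
             forall z : cocycle (cochain_differential C N) p,
               exists2 w : cocycle d p,
                 \val w = lam p (\val z) &
                 lamH (cohomology_class z) = cohomology_class w)].
Proof.
have graph p : exists f : {linear cochains C N p -> forms Lam p},
    (forall F, lambda_graph F (f F)) /\ forall F w, lambda_graph F w -> f F = w.
  apply: linear_of_relation.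
  - exact: lambda_graph_total.
  - exact: lambda_graph0.
  - exact: lambda_graph_linear.
pose lam p := projT1 (cid (graph p)).
have lamP p F : lambda_graph F (lam p F) := (projT2 (cid (graph p))).1 F.
have lamE p F w : lambda_graph F w -> lam p F = w :=
  (projT2 (cid (graph p))).2 F w.
have lam_surj p : (0 < p)%N \/ linsub_set C (cst 1) ->
    forall w, exists F, lam p F = w.
  by move=> pC w; have [F /lamE] := lambda_graph_surjective N w pC; exists F.
exists lam; split=> //.
- split=> [F f Cf Ff|p F n g f Cg Cf Ff].
    have w0 : linsub_set (forms_sub Lam 0) f.
      apply: lspan_gen; exists f, (fun=> f); split=> //.
      exact: with_constants_sub.
    by rewrite (lamE _ F (subspace_Sub w0))//; exists f.
  have wf : linsub_set (forms_sub Lam p.+1) (\sum_i simple_form Lam (g i) (f i)).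
    by apply/forms_subP; exists n, g, f.
  by rewrite (lamE _ F (subspace_Sub wf))//; exists n, g, f.
- move=> lam' [lam0 lamS] p F; apply/esym/lamE.
  have := lamP p F; case: p F => [|p] F /=.
    by move=> [f Cf [Ff _]]; exists f => //; split=> //; exact: lam0.
  by move=> [n [g [f [Cg Cf Ff _]]]]; exists n, g, f; split=> //; exact: lamS.
- apply/seteqP; split=> [_ [F _ <-]|f Cf].
    by have [f Cf [_ ->]] := lamP 0%N F.
  have SF : linsub_set (cochains_sub C N 0)
      (restrictN (N 0%N) (fun x => f (x ord0))).
    exists (fun x => f (x ord0)) => //; apply: lspan_gen.
    by exists (fun=> f); split=> [//|[]//|]; rewrite Alt_tensor_ord1.
  have w0 : linsub_set (forms_sub Lam 0) f.
    apply: lspan_gen; exists f, (fun=> f); split=> //.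
    exact: with_constants_sub.
  exists (subspace_Sub SF) => //.
  by rewrite (lamE _ _ (subspace_Sub w0))//; exists f.
- move=> d dP.
  have comm p F : d p (lam p F) = lam p.+1 (cochain_differential C N p F).
    by apply/esym/lamE; apply: lambda_graph_delta.
  by split=> //; exact: cohomology_map.
Qed.
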